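(* Let $G$ be a finite plane graph and $\mathcal{H}$ a collection of connected vertex sets of $G$ that spans $G$. Then there is a fortification $G'$ of $G$ and a collection $\mathcal{M}$ such that $\mathcal{H}$ $8$-spans $G'$ and $(G',\mathcal{M})$ is a $(73936,80)$-impression of $(G',\mathcal{H})$.
   Context: A plane graph is a planar graph with a fixed embedding; the outer face is the unbounded face. Vertex set $A$ is connected if $G[A]$ is connected. $\mathcal{H}$ spans $G$ if every edge of $G$ has both ends in some member of $\mathcal{H}$. $\mathbf{RIG}(X,\mathcal{C})$ is the graph on $\mathcal{C}$ with distinct members adjacent iff they intersect. $\mathcal{C}$ $z$-spans $X$ if for every edge $uv$ of $X$ there exist $C_u\ni u$, $C_v\ni v$ in $\mathcal{C}$ with $d_{\mathbf{RIG}(X,\mathcal{C})}(C_u,C_v)\le z$. Weak diameter of $A$ in graph $Y$: $\max_{a,b\in A}d_Y(a,b)$. $I_{\mathcal{C}}(F)$: members of $\mathcal{C}$ meeting $F$. Disjoint sets touch if an edge joins them; $\mathbf{IM}(X,\mathcal{M})$ is the graph on a collection $\mathcal{M}$ of pairwise disjoint connected sets with distinct members adjacent iff they touch. $(X,\mathcal{M})$ is an $(x,y)$-impression of $(X,\mathcal{C})$ if $\mathcal{M}$ consists of pairwise disjoint connected sets of $X$ with union $V(X)$, $I_{\mathcal{C}}(M)$ has weak diameter $\le x$ in $\mathbf{RIG}(X,\mathcal{C})$ for each $M\in\mathcal{M}$, and $I_{\mathcal{M}}(C)$ has weak diameter $\le y$ in $\mathbf{IM}(X,\mathcal{M})$ for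 each $C\in\mathcal{C}$. If an edge $e$ is drawn inside a face of $G$, it splits that face into two regions, the sides of $e$. A plane graph $G'$ is a fortification of $G$ if it is obtained from $G$ by adding edges drawn inside faces of $G$ such that one can choose a side $F_e$ of each new edge $e$ with the interiors of $F_e,F_{e'}$ disjoint for distinct new edges, and no $F_e$ containing an edge incident to the outer face of $G$. *)

(* Defs.v *)
From HB Require Import structures.
From mathcomp Require Import all_boot all_order all_algebra.
From mathcomp Require Import mathcomp_extra boolp classical_sets functions.
From mathcomp Require Import set_interval reals topology normedtype.

Set Implicit Arguments.
Unset Strict Implicit.
Unset Printing Implicit Defensive.

Import Order.TTheory GRing.Theory Num.Theory.
Import numFieldNormedType.Exports.

(** Graphs on a finite type [T] are relations [e : rel T]. *)

Section Graphs.
Variable T : finType.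
Implicit Types (e : rel T) (A B : {set T}) (C M : {set {set T}}).

(* The distance between x and y in e is at most n; no walk means an infinite
   distance. *)
Definition dist_le e (n : nat) (x y : T) : Prop :=
  exists p : seq T, [/\ path e x p, last x p = y & size p <= n].

Definition weak_diam_le e A (n : nat) : Prop :=
  {in A &, forall a b, dist_le e n a b}.

Definition induced e A : rel T :=
  [rel u v | [&& u \in A, v \in A & e u v]].

(* Connected graphs are nonempty. *)
Definition connected_set e A : Prop :=
  A != finset.set0 /\ {in A &, forall u v, connect (induced e A) u v}.

Definition spans e C : Prop :=
  forall u v, e u v -> exists2 A, A \in C & (u \in A) && (v \in A).

Definition meeting C A : {set {set T}} :=
  [set B in C | ~~ [disjoint B & A]]%SET.

Definition touch e A B : bool := [exists u in A, exists v in B, e u v].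

End Graphs.

Section Collections.
Variable T : finType.
Implicit Types (e : rel T) (C M : {set {set T}}).

(* RIG and IM are graphs on the members of the collection; sets outside the
   collection are isolated in the relations below. *)
Definition RIG C : rel {set T} :=
  [rel A B | [&& A \in C, B \in C, A != B & ~~ [disjoint A & B]]].

Definition IM e M : rel {set T} :=
  [rel A B | [&& A \in M, B \in M, A != B & touch e A B]].

Definition zspans e C (z : nat) : Prop :=
  forall u v, e u v -> exists Cu Cv : {set T},
    [/\ Cu \in C, Cv \in C, u \in Cu, v \in Cv & dist_le (RIG C) z Cu Cv].

Definition impression e C M (x y : nat) : Prop :=
  [/\ {in M, forall A, connected_set e A},
      finset.trivIset M,
      finset.cover M = [set: T]%SET,
      {in M, forall A, weak_diam_le (RIG C) (meeting C A) x} &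
      {in C, forall A, weak_diam_le (IM e M) (meeting M A) y}].

End Collections.

Local Open Scope ring_scope.
Local Open Scope classical_set_scope.

Section PlaneGraphs.
Variable R : realType.

(* A is a simple arc in the plane with ends a and b. *)
Definition is_arc (a b : R * R) (A : set (R * R)) : Prop :=
  exists f : R -> R * R,
    [/\ {within `[0, 1], continuous f},
        {in `[0, 1] &, injective f},
        f 0 = a, f 1 = b & A = f @` `[0, 1]].

(* A finite simple graph drawn in the plane. An edge is the set of its two
   ends; [curve] is only relevant on [edges], where it is the closed arc that
   represents the edge. *)
Record plane_graph (V : finType) := PlaneGraph {
  pos : V -> R * R;
  edges : {set {set V}};
  curve : {set V} -> set (R * R);
  pos_inj : injective pos;
  edge_arc : forall e, e \in edges -> exists u v : V,
    [/\ u != v, e = [set u; v]%SET & is_arc (pos u) (pos v) (curve e)];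
  edge_vertex : forall e w, e \in edges -> curve e (pos w) -> w \in e;
  edge_edge : forall e e', e \in edges -> e' \in edges -> e != e' ->
    curve e `&` curve e' `<=` range pos
}.

Variable V : finType.
Implicit Types (G : plane_graph V) (F S : set (R * R)) (e : {set V}).

Definition adj G : rel V := [rel u v | [set u; v]%SET \in edges G].

Definition drawing G : set (R * R) :=
  range (pos G) `|` \bigcup_(e in [set` edges G]) curve G e.

Definition face G F : Prop :=
  exists2 p, (~` drawing G) p & F = connected_component (~` drawing G) p.

Definition outer_face G F : Prop := face G F /\ ~ bounded_set F.

Definition incident G e F : Prop := curve G e `<=` closure F.

(* Sides are taken closed: faces are open and disjoint from the drawing, so only
   a closed side can contain an edge of G. If A joins two components of the
   graph then F `\` A is connected and its closure is the only side. *)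
Definition side F (A S : set (R * R)) : Prop :=
  exists2 p, (F `\` A) p & S = closure (connected_component (F `\` A) p).

Definition fortification G G' : Prop :=
  [/\ pos G' =1 pos G,
      edges G \subset edges G',
      {in edges G, curve G' =1 curve G} &
      exists Fe : {set V} -> set (R * R),
      [/\ {in edges G' :\: edges G, forall e,
            exists F, [/\ face G F,
                          curve G' e `\` range (pos G) `<=` F &
                          side F (curve G' e) (Fe e)]},
          {in edges G' :\: edges G &, forall e e', e != e' ->
            (Fe e)° `&` (Fe e')° = set0} &
          {in edges G' :\: edges G, forall e,
            forall F e0, outer_face G F -> e0 \in edges G ->
              incident G e0 F -> ~ curve G e0 `<=` Fe e}]].

Lemma adj_sym G : symmetric (adj G).
Proof. by move=> u v; rewrite /adj /= finset.setUC. Qed.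

Lemma adj_irrefl G : irreflexive (adj G).
Proof.
move=> u; apply/negP => /edge_arc [v [w [nvw /setP E _]]]; move: nvw.
move: (E v) (E w); rewrite !inE !eqxx ?orbT !orbb => /eqP-> /eqP->.
by rewrite eqxx.
Qed.

End PlaneGraphs.

(* Main.v *)
(** No new edge is needed: G' = G works, and planarity only enters through the
    absence of a K_5 minor.

    Measure distances inside a vertex set U by the number of pieces of members
    of [H] (components of their traces on U) that have to be chained. The
    vertices are handed over to owners step by step. Every component C of the
    unassigned part carries a bag of owners. If all of them still touch C, then
    they are at most three, since together with C they form a clique minor; a
    new owner is created, whose core is a tripod of geodesics of C that touches
    the three old ones. If some owner of the bag has been cut off from C, then
    the younger owners around C absorb the vertices of C at distance one from
    them, oldest first, and the bag shrinks. An owner does so a bounded number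
    of times, so its vertices stay close to its core, and cutting the cores into
    long blocks produces the cells of the impression. The vertices
    of a member of [H] that belong to its oldest owner are attached to nearby
    blocks; removing them and recursing, at most four times, bounds the image of
    the member in the cell graph.

    For the absence of a K_5 minor, the drawing is rounded to a fine grid so that
    disjoint edges remain disjoint. Counting modulo 2 how the lattice paths cross
    the vertical rays that start at the five branch points then gives a
    contradiction. *)
Require Import Defs.
From HB Require Import structures.
From mathcomp Require Import all_boot all_order all_algebra.
From mathcomp Require Import reals.
From mathcomp Require Import zify ring lra.
From Stdlib Require Import Btauto.

Set Implicit Arguments.
Unset Strict Implicit.
Unset Printing Implicit Defensive.
Import Order.TTheory GRing.Theory Num.Theory.

(** * Link distance *)

(** A bag may hold an owner that no longer borders its component, and such an owner must be
    forgotten before the clique argument applies again. Forgetting is dangerous: the bound on the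
    final recursion rests on the oldest owner met by a piece of a member of [H] being in a bag of at
    most four, and a piece may reach from the component to the forgotten owner. Such a piece leaves
    the component across a younger owner that still borders it, so handing over all vertices whose
    pieces touch these younger owners makes forgetting safe. The price is that owners thicken. They
    pay with their rank: an owner absorbs only when an older one is forgotten, so around the
    remaining vertices its rank improves, at most three times, and the radii 40, 600, 8400 are
    solved from this recursion. Absorbing along a whole core at once could chain far; the two
    colours of its blocks are treated separately, so that a component of the absorbed set stays
    beside one block. Distances are measured inside the region in which an owner was born; an
    estimate in a region stays valid in every larger one, hence for all older owners around the same
    component. *)

Section LinkMetric.
Variables (V : finType) (g : rel V) (H : {set {set V}}).
Hypothesis g_sym : symmetric g.
Implicit Types (A B C K U X Y : {set V}) (x y z u v w : V) (m n : nat).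

Lemma induced_sym X : symmetric (induced g X).
Proof. by move=> x y; rewrite /induced /= g_sym andbCA. Qed.

Lemma conn_sym X : connect_sym (induced g X).
Proof. by apply: sym_connect_sym; apply: induced_sym. Qed.

Lemma conn_sub X Y x y : X \subset Y ->
  connect (induced g X) x y -> connect (induced g Y) x y.
Proof.
move=> /subsetP sXY; apply: connect_sub => u v /and3P[uX vX guv].
by apply: connect1; rewrite /induced /= !sXY.
Qed.

Lemma conn_in X x y : x \in X -> connect (induced g X) x y -> y \in X.
Proof.
move=> xX /connectP[p]; elim: p x xX => [|z p IH] x xX /=; first by move=> _ ->.
by case/andP=> /and3P[_ zX _] pz /(IH _ zX pz).
Qed.

Lemma conn_edge X x y : x \in X -> y \in X -> g x y -> connect (induced g X) x y.
Proof. by move=> xX yX gxy; apply: connect1; apply/and3P. Qed.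

Lemma conn_exit X (P : pred V) x y :
  connect (induced g X) x y -> P x -> ~~ P y ->
  exists u v, [/\ u \in X, v \in X, P u & ~~ P v] /\
    g u v /\ connect (induced g [set z in X | P z]) x u.
Proof.
move=> /connectP[p]; elim: p x => [|z p IH] x /=; first by move=> _ -> ->.
case/andP=> /and3P[xX zX gxz] pz lasty Px nPy.
have [Pz|nPz] := boolP (P z); last first.
  by exists x, z; split=> //; split=> //; apply: connect0.
have [u [v [h [guv cu]]]] := IH _ pz lasty Pz nPy.
exists u, v; split=> //; split=> //; apply: connect_trans cu.
by apply: conn_edge => //; rewrite inE ?xX ?zX.
Qed.

Lemma conn_comp X x y : x \in X ->
  connect (induced g X) x y ->
  connect (induced g [set z in X | connect (induced g X) x z]) x y.
Proof.
move=> xX /connectP[p pp ->]; elim/last_ind: p pp => [|p z IH]; first by [].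
rewrite rcons_path last_rcons => /andP[pp /and3P[lX zX glz]].
have cl : connect (induced g X) x (last x p) by apply/connectP; exists p.
apply: connect_trans (IH pp) _; apply: conn_edge; rewrite // inE ?lX ?zX //=.
by apply: connect_trans cl _; apply: conn_edge.
Qed.

(** Using components of [A :&: U] instead of [A] keeps every link inside [U] and makes links
    monotone in [U] ([lnk_sub]). Reflexivity turns [nd U n] into a bound rather than an exact
    length. *)
Definition lnk U : rel V := [rel x y | (x == y) ||
  [exists A in H, [&& x \in A :&: U, y \in A :&: U &
                      connect (induced g (A :&: U)) x y]]].

Fixpoint nd U n x y : bool :=
  if n is n'.+1 then [exists z, lnk U x z && nd U n' z y] else x == y.

Lemma lnk_refl U : reflexive (lnk U).
Proof. by move=> x; rewrite /lnk /= eqxx. Qed.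

Lemma lnk_sym U : symmetric (lnk U).
Proof.
suff h x y : lnk U x y -> lnk U y x by move=> x y; apply/idP/idP => /h.
case/orP=> [/eqP->|/exists_inP[A AH /and3P[xA yA c]]]; first exact: lnk_refl.
by apply/orP; right; apply/exists_inP; exists A; rewrite // xA yA conn_sym.
Qed.

Lemma lnk_sub U U' x y : U \subset U' -> lnk U x y -> lnk U' x y.
Proof.
move=> sU /orP[/eqP->|/exists_inP[A AH /and3P[xA yA c]]]; first exact: lnk_refl.
apply/orP; right; have s : A :&: U \subset A :&: U' by rewrite setIS.
by apply/exists_inP; exists A; rewrite // !(subsetP s) //= (conn_sub s).
Qed.

Lemma lnk_in U x y : x \in U -> lnk U x y -> y \in U.
Proof.
move=> xU /orP[/eqP<-//|/exists_inP[A _ /and3P[_ yA _]]].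
by case/setIP: yA.
Qed.

Lemma lnk_piece U K A x y : A \in H -> K \subset A -> K \subset U ->
  x \in K -> connect (induced g K) x y -> lnk U x y.
Proof.
move=> AH sA sU xK c; have yK := conn_in xK c.
have s : K \subset A :&: U by rewrite subsetI sA.
apply/orP; right; apply/exists_inP; exists A => //.
by rewrite !(subsetP s) //= (conn_sub s).
Qed.

Lemma nd_lnk U x y : lnk U x y -> nd U 1 x y.
Proof. by move=> h; apply/existsP; exists y; rewrite h /=. Qed.

Lemma nd_trans U m n x y z : nd U m x y -> nd U n y z -> nd U (m + n) x z.
Proof.
elim: m x => [|m IH] x /=; first by move=> /eqP->.
case/existsP=> w /andP[xw wy] yz; apply/existsP; exists w.
by rewrite xw IH.
Qed.

Lemma nd_refl U n x : nd U n x x.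
Proof.
by elim: n => [|n IH] /=; [|apply/existsP; exists x; rewrite lnk_refl].
Qed.

Lemma nd_leq U m n x y : m <= n -> nd U m x y -> nd U n x y.
Proof. by move=> /subnK<- h; rewrite addnC; apply: nd_trans h (nd_refl _ _ _). Qed.

Lemma nd_symm U n x y : nd U n x y -> nd U n y x.
Proof.
elim: n x y => [|n IH] x y /=; first by rewrite eq_sym.
case/existsP=> z /andP[xz /IH zy]; rewrite lnk_sym in xz.
by have := nd_trans zy (nd_lnk xz); rewrite addn1.
Qed.

Lemma nd_sub U U' n x y : U \subset U' -> nd U n x y -> nd U' n x y.
Proof.
move=> sU; elim: n x => [|n IH] x //= /existsP[z /andP[xz zy]].
by apply/existsP; exists z; rewrite (lnk_sub sU) ?IH.
Qed.

Lemma ndSr U n x y : nd U n.+1 x y -> exists2 z, nd U n x z & lnk U z y.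
Proof.
move=> /nd_symm /= /existsP[z /andP[yz zx]].
by exists z; [apply: nd_symm | rewrite lnk_sym].
Qed.

Hypothesis g_spans : spans g H.

Lemma lnk_edge U x y : x \in U -> y \in U -> g x y -> lnk U x y.
Proof.
move=> xU yU gxy; have [A AH /andP[xA yA]] := g_spans gxy.
by apply: (@lnk_piece U (A :&: U) A); rewrite ?subsetIl ?subsetIr ?inE ?xA //;
   apply: conn_edge; rewrite ?inE ?xA ?yA.
Qed.

Lemma conn_nd U x y : connect (induced g U) x y -> exists n, nd U n x y.
Proof.
move=> /connectP[p]; elim: p x => [|z p IH] x /=.
  by move=> _ ->; exists 0; apply: nd_refl.
case/andP=> /and3P[xU zU gxz] pz /(IH _ pz)[n h]; exists n.+1 => /=.
by apply/existsP; exists z; rewrite h lnk_edge.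
Qed.

Definition within U A n x := [exists a in A, nd U n a x].

Lemma within_trans U A m n x y : within U A m x -> nd U n x y ->
  within U A (m + n) y.
Proof.
by case/exists_inP=> a aA h k; apply/exists_inP; exists a => //; apply: nd_trans h k.
Qed.

(* The cut-off N only makes the level a total function. *)
Definition lev U A N x := find (fun n => within U A n x) (iota 0 N.+1).

Lemma levP U A N x : within U A N x -> within U A (lev U A N x) x.
Proof.
move=> h; have hh : has (fun n => within U A n x) (iota 0 N.+1).
  by apply/hasP; exists N => //; rewrite mem_iota /= ltnS.
have := nth_find 0 hh; rewrite nth_iota ?add0n //.
by rewrite -[X in _ < X](size_iota 0) -has_find.
Qed.

Lemma lev_le U A N x n : n <= N -> within U A n x -> lev U A N x <= n.
Proof.
move=> nN h; rewrite leqNgt; apply/negP => lt.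
have := before_find 0 lt; rewrite nth_iota ?add0n ?h //.
Qed.

Lemma lev_lip U A N x y n : within U A N x -> within U A N y -> nd U n x y ->
  lev U A N y <= lev U A N x + n.
Proof.
move=> hx hy h; have [le|lt] := leqP (lev U A N x + n) N.
  exact: lev_le le (within_trans (levP hx) h).
exact: leq_trans (lev_le (leqnn N) hy) (ltnW lt).
Qed.

Lemma lev0 U A N x : within U A N x -> (lev U A N x == 0) = (x \in A).
Proof.
move=> hx; apply/eqP/idP => [e|xA].
  by have := levP hx; rewrite e => /exists_inP[a aA /= /eqP<-].
apply/eqP; rewrite -leqn0; apply: lev_le => //.
by apply/exists_inP; exists x => //=.
Qed.

(** A geodesic of links is not a walk of [g], since one link may jump across a whole piece. The
    chain [S] is therefore a thickened geodesic: on each positive level it keeps a connected part of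
    a single piece, and an edge leads from there to the next lower level. This costs only the extra
    1 in the distance bound. *)
Lemma level_chain U A N x n : A \subset U -> x \in U ->
  {in U, forall y, within U A N y} -> lev U A N x = n ->
  exists (S : {set V}) (e : V),
  [/\ S \subset U, x \in S, e \in S & e \in A] /\
  [/\ forall w, w \in S -> (lev U A N w == 0) = (w == e),
      forall w, w \in S -> lev U A N w <= n,
      forall w, w \in S -> nd U (lev U A N w) w e,
      {in S &, forall w w',
        nd U ((lev U A N w - lev U A N w') + (lev U A N w' - lev U A N w)).+1 w w'} &
      {in S &, forall w w', connect (induced g [set z in S |
        minn (lev U A N w) (lev U A N w') <= lev U A N z <=
        maxn (lev U A N w) (lev U A N w')]) w w'}].
Proof.
move=> sAU + hN; set l := lev U A N; elim: n x => [|n IH] x xU lx.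
  have xA : x \in A by rewrite -(lev0 (hN x xU)) -/l lx.
  exists [set x], x; split; first by rewrite sub1set set11.
  split=> [w|w|w|w w'|w w']; rewrite !inE => /eqP->.
  - by rewrite -/l lx !eqxx.
  - by rewrite lx.
  - by rewrite lx /=.
  - by move=> /eqP->; apply: nd_refl.
  - by move=> /eqP->; apply: connect0.
have := levP (hN x xU); rewrite -/l lx => /exists_inP[a aA] /ndSr[z az zx].
have zU : z \in U by rewrite (@lnk_in U x) // lnk_sym.
have lzn : l z <= n.
  by rewrite /l; apply: lev_le; [have := @lev_le U A N x N (leqnn _) (hN x xU);
    rewrite -/l lx => /ltnW | apply/exists_inP; exists a].
have lzn' : l x <= l z + 1 by apply: lev_lip (nd_lnk zx); apply: hN.
have neq : x != z by apply: contraTneq lzn => <-; rewrite lx ltnn.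
rewrite lnk_sym in zx.
case/orP: zx neq => [/eqP-> /eqP//|/exists_inP[B BH /and3P[xB zB c]] _].
(* [W] is the piece that links [x] to its predecessor [z]. Any two of its vertices are linked, so
   only the levels [n] and [n.+1] occur on it. *)
set W := [set w in B :&: U | connect (induced g (B :&: U)) x w].
have WU w : w \in W -> w \in U by rewrite !inE => /andP[/andP[]].
have Wl w w' : w \in W -> w' \in W -> lnk U w w'.
  rewrite !in_set => /andP[/andP[wB wU] cw] /andP[_ cw'].
  apply: (@lnk_piece U (B :&: U) B); rewrite ?subsetIl ?subsetIr ?inE ?wB //.
  by apply: connect_trans cw'; rewrite conn_sym.
have xW : x \in W by rewrite in_set xB connect0.
have zW : z \in W by rewrite in_set zB c.
have lW w : w \in W -> n <= l w <= n.+1.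
  move=> wW; have h1 : l x <= l w + 1.
    by apply: lev_lip (nd_lnk (Wl _ _ wW xW)); apply: hN => //; apply: WU.
  have h2 : l w <= l z + 1.
    by apply: lev_lip (nd_lnk (Wl _ _ zW wW)); apply: hN => //; apply: WU.
  by move: h1 h2 lx lzn lzn'; clear; lia.
have cW : connect (induced g W) x z by apply: conn_comp.
have [||u [y [[uW yW lu ly] [guy cu]]]] := @conn_exit W (fun w => l w == n.+1) x z cW.
- by rewrite lx.
- by apply/negP => /eqP e; move: e lzn; clear; lia.
have {}ly : l y = n by move/eqP: ly (lW _ yW); clear; lia.
set St := [set w in W | l w == n.+1] in cu.
set St' := [set w in St | connect (induced g St) x w].
have StW w : w \in St' -> w \in W /\ l w = n.+1.
  by rewrite !in_set => /andP[/andP[? /eqP ?] _].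
have xSt : x \in St by rewrite in_set xW lx eqxx.
have cSt w w' : w \in St' -> w' \in St' -> connect (induced g St') w w'.
  rewrite !in_set => /andP[wS cw] /andP[wS' cw'].
  by apply: connect_trans (conn_comp xSt cw'); rewrite conn_sym; apply: conn_comp.
have xS' : x \in St' by rewrite in_set xSt connect0.
have uS' : u \in St' by rewrite in_set cu in_set uW lu.
have [S [e [[sSU yS eS eA] [he hle hnd hdd hcc]]]] := IH y (WU _ yW) ly.
exists (St' :|: S), e; split.
  split=> //; rewrite ?in_setU ?xS' ?eS ?orbT // subUset sSU andbT.
  by apply/subsetP => w /StW[/WU].
have mix w w' : w \in St' -> w' \in S ->
    nd U ((l w - l w') + (l w' - l w)).+1 w w'.
  move=> wS wS'; have [wW lw] := StW _ wS; have lw' := hle _ wS'.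
  have h1 := nd_lnk (Wl _ _ wW yW); have h2 := hdd _ _ yS wS'.
  apply: nd_leq (nd_trans h1 h2); move: lw lw' ly; rewrite -/l; clear; lia.
have mixc w w' : w \in St' -> w' \in S -> connect (induced g [set z in St' :|: S |
        minn (l w) (l w') <= l z <= maxn (l w) (l w')]) w w'.
  move=> wS wS'; have [wW lw] := StW _ wS; have lw' := hle _ wS'.
  apply: (@connect_trans _ _ u).
    apply: conn_sub (cSt _ _ wS uS'); apply/subsetP => t tS.
    rewrite inE in_setU tS /=; have [_ ->] := StW _ tS.
    by move: lw lw'; rewrite -/l; clear; lia.
  apply: (@connect_trans _ _ y).
    apply: conn_edge => //; rewrite inE in_setU ?uS' ?yS ?orbT /=.
      have [_ ->] := StW _ uS'; by move: lw lw'; rewrite -/l; clear; lia.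
    by move: ly lw lw'; rewrite -/l; clear; lia.
  apply: conn_sub (hcc _ _ yS wS'); apply/subsetP => t.
  rewrite !inE => /andP[-> ]; rewrite orbT /=; move: ly lw lw'; rewrite -/l; clear; lia.
split.
- move=> w /setUP[/StW[wW lw]|/he//]; rewrite lw /=; apply/esym/eqP => we.
  by move: lw; rewrite we; have := he _ eS; rewrite eqxx => /eqP ->.
- by move=> w /setUP[/StW[_ ->]//|/hle]; rewrite -/l; clear; lia.
- move=> w /setUP[/StW[wW lw]|/hnd//]; rewrite lw.
  have h := hnd _ yS; rewrite -/l ly in h.
  by apply: (nd_trans (nd_lnk (Wl _ _ wW yW)) h).
- move=> w w' /setUP[wS|wS] /setUP[wS'|wS'].
  + have [wW lw] := StW _ wS; have [wW' lw'] := StW _ wS'.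
    by apply: nd_leq (nd_lnk (Wl _ _ wW wW')); rewrite lw lw' subnn.
  + exact: mix.
  + by apply: nd_symm; have := mix _ _ wS' wS; rewrite addnC.
  + exact: hdd.
- move=> w w' /setUP[wS|wS] /setUP[wS'|wS'].
  + have [wW lw] := StW _ wS; have [wW' lw'] := StW _ wS'.
    apply: conn_sub (cSt _ _ wS wS'); apply/subsetP => t tS.
    by rewrite inE in_setU tS /=; have [_ ->] := StW _ tS; rewrite lw lw' minnn maxnn leqnn.
  + exact: mixc.
  + by rewrite conn_sym minnC maxnC; apply: mixc.
  + apply: conn_sub (hcc _ _ wS wS'); apply/subsetP => t.
    by rewrite !inE => /andP[-> ->]; rewrite orbT.
Qed.

End LinkMetric.

(** * Cores *)

Section Blocks.
Variables (l : nat) (l_gt0 : 0 < l).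

Lemma div_near x y : x < y + l -> x %/ l <= (y %/ l).+1.
Proof.
move=> h; have := leq_div2r l (ltnW h).
by rewrite divnDr // divnn l_gt0 addn1.
Qed.

Lemma div_eq0 x : (x %/ l == 0) = (x < l).
Proof. by rewrite -leqn0 leqNgt divn_gt0 // -ltnNge. Qed.

Definition gap c x := (x - c) + (c - x).

(* Blocks of length l on both sides of c, the block around c being doubled;
   the value 3 i + 2 is reserved for a third branch. *)
Definition pblock c x :=
  if gap c x %/ l == 0 then 0 else 3 * (gap c x %/ l) + (c < x).

Definition qblock x := if x %/ l == 0 then 0 else 3 * (x %/ l) + 2.

Lemma gap_side c x y : (c < x) = (c < y) -> gap y x = gap (gap c y) (gap c x).
Proof. by rewrite /gap; lia. Qed.

Lemma gap_opp c x y : (c < x) != (c < y) -> gap y x = gap c x + gap c y.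
Proof. by rewrite /gap; case: ltnP; case: ltnP => //=; lia. Qed.

(** On one side of [c], indices of points less than [l] apart differ by at most one, so parity
    decides. On opposite sides, both points lie in the doubled block around [c]. *)
Lemma pblock_col c x y : gap y x < l ->
  odd (gap c x %/ l) = odd (gap c y %/ l) -> pblock c x = pblock c y.
Proof.
move=> h ho; rewrite /pblock.
have [e|ne] := eqVneq (c < x) (c < y); last first.
  by move: h; rewrite (gap_opp ne) => h; rewrite !div_eq0 !ifT //; lia.
rewrite (gap_side e) in h.
have h1 : gap c x %/ l <= (gap c y %/ l).+1 by apply: div_near; move: h; rewrite /gap; lia.
have h2 : gap c y %/ l <= (gap c x %/ l).+1 by apply: div_near; move: h; rewrite /gap; lia.
suff -> : gap c x %/ l = gap c y %/ l by rewrite e.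
by move: ho h1 h2; clear; lia.
Qed.

Lemma pblock_eq c x y : pblock c x = pblock c y ->
  (gap c x < l /\ gap c y < l) \/
  (gap c x %/ l = gap c y %/ l /\ (c < x) = (c < y)).
Proof.
rewrite /pblock; case: eqP => [/eqP|] h1; case: eqP => [/eqP|] h2 H.
- by rewrite !div_eq0 in h1 h2; left.
- by move: h2 H; move: (gap c y %/ l) => i; lia.
- by move: h1 H; move: (gap c x %/ l) => i; lia.
- by right; move: h1 h2 H; move: (gap c x %/ l) (gap c y %/ l) => i j; lia.
Qed.

Lemma pblock_size c x y : pblock c x = pblock c y -> gap y x < 2 * l.
Proof.
case/pblock_eq=> [[]|[e s]]; first by rewrite /gap; lia.
rewrite (gap_side s); have h1 := divn_eq (gap c x) l; have h2 := divn_eq (gap c y) l.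
have m1 := ltn_pmod (gap c x) l_gt0; have m2 := ltn_pmod (gap c y) l_gt0.
move: h1 h2 m1 m2; rewrite e.
move: (gap c x %% l) (gap c y %% l) (gap c y %/ l * l) (gap c x) (gap c y).
by move=> a b q X Y; rewrite /gap; lia.
Qed.

Lemma pblock_between c x y z : gap y x < l ->
  minn x y <= z <= maxn x y -> pblock c z = pblock c x \/ pblock c z = pblock c y.
Proof.
move=> h hz; rewrite /pblock.
have [e|ne] := eqVneq (c < x) (c < y); last first.
  left; move: h; rewrite (gap_opp ne) => h; rewrite !div_eq0 !ifT //; first by lia.
  by move: h hz ne; rewrite /gap; lia.
have ez : (c < z) = (c < x) by move: e hz; lia.
have hd : (gap c x <= gap c z <= gap c y) || (gap c y <= gap c z <= gap c x).
  by move: e hz; rewrite /gap; lia.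
rewrite (gap_side e) in h.
have h1 : gap c x %/ l <= (gap c y %/ l).+1 by apply: div_near; move: h; rewrite /gap; lia.
have h2 : gap c y %/ l <= (gap c x %/ l).+1 by apply: div_near; move: h; rewrite /gap; lia.
have : gap c z %/ l = gap c x %/ l \/ gap c z %/ l = gap c y %/ l.
  case/orP: hd => /andP[/(leq_div2r l) a /(leq_div2r l) b]; lia.
by rewrite ez -e; case=> ->; [left|right].
Qed.

Lemma pblock_convex c x y z : pblock c x = pblock c y ->
  minn x y <= z <= maxn x y -> pblock c z = pblock c x.
Proof.
move=> hxy hz; have [[h1 h2]|[e s]] := pblock_eq hxy.
  by rewrite /pblock !div_eq0 h1 ifT //; move: h1 h2 hz; rewrite /gap; lia.
have ez : (c < z) = (c < x) by move: s hz; lia.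
have hd : (gap c x <= gap c z <= gap c y) || (gap c y <= gap c z <= gap c x).
  by move: s hz; rewrite /gap; lia.
rewrite /pblock ez; suff -> : gap c z %/ l = gap c x %/ l by [].
by case/orP: hd => /andP[/(leq_div2r l) a /(leq_div2r l) b]; lia.
Qed.

Lemma qblockE x : qblock x = if x %/ l == 0 then 0 else (pblock 0 x).+1.
Proof.
by rewrite /qblock /pblock /gap !subn0 sub0n addn0 div_eq0; case: ltnP => //; lia.
Qed.

Lemma pblock0_eq0 x : (pblock 0 x == 0) = (x %/ l == 0).
Proof.
rewrite /pblock /gap subn0 sub0n addn0; move: (x %/ l) => i.
by case: (i == 0) / eqP; lia.
Qed.

Lemma qblock_inj x y : (qblock x = qblock y) <-> (pblock 0 x = pblock 0 y).
Proof.
rewrite !qblockE -!pblock0_eq0; move: (pblock 0 x) (pblock 0 y) => i j.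
by case: eqP; case: eqP; lia.
Qed.

Lemma pq_block c x y : pblock c x = qblock y -> gap c x < l /\ y < l.
Proof.
rewrite /pblock /qblock; case: eqP => [/eqP|] h1; case: eqP => [/eqP|] h2 e.
- by rewrite !div_eq0 in h1 h2.
- by move: h2 e; move: (y %/ l) => i; lia.
- by move: h1 e; move: (gap c x %/ l) => i; lia.
- by move: e; move: (gap c x %/ l) (y %/ l) => i j; lia.
Qed.

End Blocks.

Section Core.
Variables (V : finType) (g : rel V) (H : {set {set V}}).
Hypothesis g_sym : symmetric g.
Hypothesis g_spans : spans g H.
Implicit Types (A B C K U X Y R T : {set V}) (x y z u v w : V) (m n : nat).
Local Notation nd := (nd g H).
Local Notation lnk := (lnk g H).

(* A core is a set that looks like a tripod of geodesics at every scale: it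
   splits into connected blocks of bounded size, two-coloured so that near
   points of one colour share their block. *)
Definition core R T : Prop := forall l, 0 < l ->
  exists (blk : V -> nat) (col : V -> bool),
  [/\ {in T &, forall w w', forall n, col w = col w' -> nd R n w w' -> n < l ->
         blk w = blk w'},
      {in T &, forall w w', blk w = blk w' -> nd R (2 * l) w w'},
      {in T &, forall w w', forall n, nd R n w w' -> n < l ->
         blk w = blk w' \/ exists x y,
           [/\ x \in T, y \in T, blk x = blk w, blk y = blk w' & g x y]} &
      {in T &, forall w w', blk w = blk w' ->
         connect (induced g [set x in T | blk x == blk w]) w w'}].

(** [P] is a chain from [b] to [a], [Q] a chain from [c] to [P], and they share only the vertex [p].
    Blocks are cut by the level [f] on [P], centred at [p], and by the level [h] on [Q], so the
    block of [p] is common to all three legs. *)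
Lemma core_exists C a b c :
  {in C &, forall x y, connect (induced g C) x y} ->
  a \in C -> b \in C -> c \in C ->
  exists T, [/\ T \subset C, a \in T, b \in T & c \in T] /\
    {in T &, forall x y, connect (induced g T) x y} /\ core C T.
Proof.
move=> cC aC bC cCC.
have exN A : A \subset C -> A != set0 -> exists N, {in C, forall y, within g H C A N y}.
  move=> sA /set0Pn[e eA]; have eC := subsetP sA _ eA.
  have h y : exists n, (y \in C) ==> nd C n e y.
    by case: (boolP (y \in C)) => [yC|]; [apply: conn_nd => //; apply: cC | exists 0].
  exists (\max_y ex_minn (h y)) => y yC; apply/exists_inP; exists e => //.
  have := leq_bigmax (F := fun y => ex_minn (h y)) y.
  by case: ex_minnP => n hn _ /= le; apply: nd_leq le _; move/implyP: hn; apply.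
have sa : [set a] \subset C by rewrite sub1set.
have na : [set a] != set0 by apply/set0Pn; exists a; rewrite inE.
have [N1 hN1] := exN [set a] sa na.
have [P [a' [[sPC bP aP]]]] := level_chain g_sym sa bC hN1 erefl.
rewrite inE => /eqP ea; move: aP; rewrite {}ea => aP {a'}.
set f := lev g H C [set a] N1 => -[_ _ _ Pnd Pcc].
have nP : P != set0 by apply/set0Pn; exists a.
have [N2 hN2] := exN P sPC nP.
have [Q [p [[sQC cQ pQ pP]]]] := level_chain g_sym sPC cCC hN2 erefl.
set h := lev g H C P N2 => -[Q0 _ Qe Qnd Qcc].
have PC w : w \in P -> w \in C := @subsetP _ _ _ sPC w.
have QC w : w \in Q -> w \in C := @subsetP _ _ _ sQC w.
have QP w : w \in Q -> w \in P -> w = p.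
  by move=> wQ wP; apply/eqP; rewrite -Q0 // lev0 //; apply/hN2/QC.
have h0 w : w \in C -> (h w == 0) = (w \in P) by move=> wC; rewrite /h lev0 //; apply: hN2.
have TC w : w \in P :|: Q -> w \in C by case/setUP=> [/PC|/QC].
have fL w w' n : w \in C -> w' \in C -> nd C n w w' -> gap (f w') (f w) <= n.
  move=> wC wC' d; have := lev_lip (hN1 _ wC) (hN1 _ wC') d.
  have := lev_lip (hN1 _ wC') (hN1 _ wC) (nd_symm g_sym d).
  by rewrite -/f /gap; clear; lia.
have hL w w' n : w \in C -> w' \in C -> nd C n w w' -> gap (h w') (h w) <= n.
  move=> wC wC' d; have := lev_lip (hN2 _ wC) (hN2 _ wC') d.
  have := lev_lip (hN2 _ wC') (hN2 _ wC) (nd_symm g_sym d).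
  by rewrite -/h /gap; clear; lia.
have cPp w : w \in P -> connect (induced g P) w p.
  move=> wP; apply: conn_sub (Pcc _ _ wP pP).
  by apply/subsetP => z; rewrite inE => /andP[].
have cQp w : w \in Q -> connect (induced g Q) w p.
  move=> wQ; apply: conn_sub (Qcc _ _ wQ pQ).
  by apply/subsetP => z; rewrite inE => /andP[].
exists (P :|: Q); split; first by rewrite subUset sPC sQC !inE aP bP cQ orbT.
split.
  have cT w : w \in P :|: Q -> connect (induced g (P :|: Q)) w p.
    by case/setUP=> [/cPp|/cQp]; apply: conn_sub; rewrite ?subsetUl ?subsetUr.
  by move=> x y /cT hx /cT hy; apply: connect_trans hx _; rewrite conn_sym.
move=> l l0; set c0 := f p.
pose blk w := if w \in P then pblock l c0 (f w) else qblock l (h w).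
pose col w := odd ((if w \in P then gap c0 (f w) else h w) %/ l).
have bP' w : w \in P -> blk w = pblock l c0 (f w) by rewrite /blk => ->.
have p0 : blk p = 0 by rewrite bP' // /pblock /gap subnn div0n.
have bQ w : w \in Q -> blk w = qblock l (h w).
  move=> wQ; rewrite /blk; case: ifP => // wP.
  have e := QP _ wQ wP; have := h0 w (PC _ wP); rewrite wP => /eqP ->.
  by rewrite e /pblock /qblock /gap subnn div0n.
have colQ w : w \in Q -> col w = odd (h w %/ l).
  move=> wQ; rewrite /col; case: ifP => // wP.
  have e := QP _ wQ wP; have := h0 w (PC _ wP); rewrite wP => /eqP ->.
  by rewrite e /gap subnn div0n.
have g0 (x : nat) : gap 0 x = x by rewrite /gap subn0 sub0n addn0.
(* The only interplay of the two chains. As [h] is the distance to [P], closeness of [w'] to [w]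
   forces [h w' <= n], and going through [w'] to [p] puts [w] within [2 * n] of [p]. So [w'] is in
   the central block and [w] has index at most one. *)
have mix w w' n : w \in P -> w' \in Q -> nd C n w w' -> n < l ->
    [/\ h w' < l, blk w' = 0 & gap c0 (f w) <= 2 * n].
  move=> wP wQ d nl; have wC := PC _ wP; have wC' := QC _ wQ.
  have h1 : h w' <= n.
    have := hL _ _ _ wC wC' d; have := h0 _ wC; rewrite wP => /eqP ->.
    by rewrite /gap; clear; lia.
  have hl : h w' < l by move: h1 nl; clear; lia.
  split=> //; first by rewrite bQ // /qblock div_eq0 // hl.
  have := fL _ _ _ (PC _ pP) wC (nd_symm g_sym (nd_trans d (Qe _ wQ))).
  by rewrite -/h -/c0 /gap; move: h1; clear; lia.
have mixd w w' : w \in P -> w' \in Q -> gap c0 (f w) < l -> h w' < l -> nd C (2 * l) w w'.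
  move=> wP wQ h1 h2; have d1 := Pnd _ _ wP pP.
  apply: nd_leq (nd_trans d1 (nd_symm g_sym (Qe _ wQ))).
  by move: h1 h2; rewrite -/h -/f /gap -/c0; clear; lia.
have seg w w' n : w \in P -> w' \in P -> gap (f w') (f w) <= n -> n < l ->
    blk w = blk w' \/ exists x y,
      [/\ x \in P :|: Q, y \in P :|: Q, blk x = blk w, blk y = blk w' & g x y].
  move=> wP wP' d nl; have [e|ne] := eqVneq (blk w) (blk w'); [by left|right].
  have [||u [v [[uI vI /eqP bu bv] [guv _]]]] :=
    @conn_exit _ g _ (fun z => blk z == blk w) _ _ (Pcc _ _ wP wP').
  - by [].
  - by rewrite eq_sym.
  exists u, v; move: uI vI; rewrite !inE => /andP[uP _] /andP[vP hv].
  rewrite uP vP bu; split=> //.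
  have := pblock_between l0 c0 (leq_ltn_trans d nl) hv.
  by rewrite -!bP' //; case=> // e; rewrite e eqxx in bv.
have segQ w w' n : w \in Q -> w' \in Q -> gap (h w') (h w) <= n -> n < l ->
    blk w = blk w' \/ exists x y,
      [/\ x \in P :|: Q, y \in P :|: Q, blk x = blk w, blk y = blk w' & g x y].
  move=> wQ wQ' d nl; have [e|ne] := eqVneq (blk w) (blk w'); [by left|right].
  have [||u [v [[uI vI /eqP bu bv] [guv _]]]] :=
    @conn_exit _ g _ (fun z => blk z == blk w) _ _ (Qcc _ _ wQ wQ').
  - by [].
  - by rewrite eq_sym.
  exists u, v; move: uI vI; rewrite !inE => /andP[uQ _] /andP[vQ hv].
  rewrite uQ vQ !orbT bu; split=> //.
  have := pblock_between l0 0 (leq_ltn_trans d nl) hv.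
  case=> /(qblock_inj l0); rewrite -!bQ // => e //; by rewrite e eqxx in bv.
exists blk, col; split.
- move=> w w' /setUP[wP|wQ] /setUP[wP'|wQ'] n.
  + rewrite /col wP wP' => hc d nl; rewrite !bP' //.
    by apply: (pblock_col l0) hc; apply: leq_ltn_trans nl; apply: fL d; apply: PC.
  + move=> hc d nl; have [hh b0 gg] := mix _ _ _ wP wQ' d nl.
    rewrite b0 bP' // /pblock div_eq0 // ifT //.
    move: hc; rewrite (colQ w') // /col wP (_ : h w' %/ l = 0); last by apply/eqP; rewrite div_eq0.
    have : gap c0 (f w) %/ l < 2 by rewrite ltn_divLR //; move: gg nl; clear; lia.
    by rewrite -(div_eq0 l0); case: (_ %/ l) => [|[|?]].
  + move=> hc d nl; have [hh b0 gg] := mix _ _ _ wP' wQ (nd_symm g_sym d) nl.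
    rewrite b0 bP' // /pblock div_eq0 // ifT //.
    move: hc; rewrite (colQ w) // /col wP' (_ : h w %/ l = 0); last by apply/eqP; rewrite div_eq0.
    have : gap c0 (f w') %/ l < 2 by rewrite ltn_divLR //; move: gg nl; clear; lia.
    by rewrite -(div_eq0 l0); case: (_ %/ l) => [|[|?]].
  + rewrite !colQ // => hc d nl; rewrite !bQ //; apply/qblock_inj => //.
    apply: (pblock_col l0); rewrite ?g0 //.
    by apply: leq_ltn_trans nl; apply: hL d; apply: QC.
- move=> w w' /setUP[wP|wQ] /setUP[wP'|wQ'].
  + rewrite !bP' // => /(pblock_size l0) d; apply: nd_leq (Pnd _ _ wP wP').
    by rewrite -/f; move: d; rewrite /gap; clear; lia.
  + by rewrite (bP' w) // (bQ w') // => /(pq_block l0)[]; apply: mixd.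
  + rewrite (bP' w') // (bQ w) // => /esym/(pq_block l0)[h1 h2].
    by apply: nd_symm => //; apply: mixd.
  + rewrite !bQ // => /(qblock_inj l0)/(pblock_size l0) d; apply: nd_leq (Qnd _ _ wQ wQ').
    by rewrite -/h; move: d; rewrite /gap; clear; lia.
- move=> w w' /setUP[wP|wQ] /setUP[wP'|wQ'] n d nl.
  + by apply: seg nl => //; apply: fL d; apply: PC.
  + have [hh b0 gg] := mix _ _ _ wP wQ' d nl.
    have [e|ne] := eqVneq (blk w) (blk w'); [by left|right].
    have [||u [v [[uI vI /eqP bu bv] [guv _]]]] :=
      @conn_exit _ g _ (fun z => blk z == blk w) _ _ (Pcc _ _ wP pP); first by [].
      by rewrite p0 -b0 eq_sym.
    exists u, v; move: uI vI; rewrite !inE => /andP[uP _] /andP[vP hv].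
    rewrite uP vP bu; split=> //.
    (* With index at most one, the chain from [w] to [p] leaves the block of [w] directly into the
       central block, which is the block of [w']. *)
    have i1 : gap c0 (f w) %/ l < 2 by rewrite ltn_divLR //; move: gg nl; clear; lia.
    move: ne bv; rewrite b0 (bP' w) // (bP' v) // /pblock !div_eq0 //.
    have [//|i2 _] := ltnP (gap c0 (f w)) l; have [//|i3] := ltnP (gap c0 (f v)) l.
    have hle : gap c0 (f v) <= gap c0 (f w) by move: hv; rewrite -/c0 /gap; clear; lia.
    have hs : (c0 < f v) = (c0 < f w).
      by move: hv i3; rewrite -/c0 /gap; move: l0; clear; lia.
    have i4 := leq_div2r l hle; have i5 : 0 < gap c0 (f v) %/ l by rewrite divn_gt0.
    have -> : gap c0 (f v) %/ l = 1.
      by apply/eqP; rewrite eqn_leq i5 andbT -ltnS; apply: leq_ltn_trans i4 i1.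
    have : 0 < gap c0 (f w) %/ l by rewrite divn_gt0.
    by case: (gap c0 (f w) %/ l) i1 => [|[|?]] //; rewrite hs eqxx.
  + have [hh b0 gg] := mix _ _ _ wP' wQ (nd_symm g_sym d) nl.
    have [e|ne] := eqVneq (blk w) (blk w'); [by left|right].
    have [||u [v [[uI vI /eqP bu bv] [guv _]]]] :=
      @conn_exit _ g _ (fun z => blk z == blk w') _ _ (Pcc _ _ wP' pP); first by [].
      by rewrite p0 -b0.
    exists v, u; move: uI vI; rewrite !inE => /andP[uP _] /andP[vP hv].
    rewrite uP vP bu g_sym; split=> //.
    have i1 : gap c0 (f w') %/ l < 2 by rewrite ltn_divLR //; move: gg nl; clear; lia.
    move: ne bv; rewrite b0 (bP' w') // (bP' v) // /pblock !div_eq0 //.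
    have [//|i2 _] := ltnP (gap c0 (f w')) l; have [//|i3] := ltnP (gap c0 (f v)) l.
    have hle : gap c0 (f v) <= gap c0 (f w') by move: hv; rewrite -/c0 /gap; clear; lia.
    have hs : (c0 < f v) = (c0 < f w').
      by move: hv i3; rewrite -/c0 /gap; move: l0; clear; lia.
    have i4 := leq_div2r l hle; have i5 : 0 < gap c0 (f v) %/ l by rewrite divn_gt0.
    have -> : gap c0 (f v) %/ l = 1.
      by apply/eqP; rewrite eqn_leq i5 andbT -ltnS; apply: leq_ltn_trans i4 i1.
    have : 0 < gap c0 (f w') %/ l by rewrite divn_gt0.
    by case: (gap c0 (f w') %/ l) i1 => [|[|?]] //; rewrite hs eqxx.
  + by apply: segQ nl => //; apply: hL d; apply: QC.
have conP w w' : w \in P -> w' \in P -> blk w = blk w' ->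
    connect (induced g [set x in P :|: Q | blk x == blk w]) w w'.
  move=> wP wP' e; apply: conn_sub (Pcc _ _ wP wP'); apply/subsetP => z.
  rewrite !inE => /andP[zP hz]; rewrite zP /=; apply/eqP; rewrite !bP' // in e *.
  exact: pblock_convex hz.
have conQ w w' : w \in Q -> w' \in Q -> blk w = blk w' ->
    connect (induced g [set x in P :|: Q | blk x == blk w]) w w'.
  move=> wP wP' e; apply: conn_sub (Qcc _ _ wP wP'); apply/subsetP => z.
  rewrite !inE => /andP[zP hz]; rewrite zP orbT /=; apply/eqP; rewrite !bQ // in e *.
  by apply/qblock_inj => //; apply: pblock_convex hz => //; apply/qblock_inj.
move=> w w' /setUP[wP|wQ] /setUP[wP'|wQ'] e; [exact: conP| | |exact: conQ].
- have [h1 h2] : gap c0 (f w) < l /\ h w' < l.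
    by apply: (pq_block l0); rewrite -bP' // -bQ.
  have b0 : blk w = 0 by rewrite bP' // /pblock div_eq0 // h1.
  apply: (@connect_trans _ _ p); first exact: (conP w p wP pP (etrans b0 (esym p0))).
  have := conQ p w' pQ wQ'; rewrite p0 -b0 => h3; exact: h3.
- have [h1 h2] : gap c0 (f w') < l /\ h w < l.
    by apply: (pq_block l0); rewrite -bP' // -bQ.
  have b0 : blk w' = 0 by rewrite bP' // /pblock div_eq0 // h1.
  apply: (@connect_trans _ _ p); first exact: (conQ w p wQ pQ (etrans e (etrans b0 (esym p0)))).
  have := conP p w' pP wP'; rewrite p0 -b0 -e => h3; exact: h3.
Qed.

End Core.

(** * Owners *)

Section Absorb.
Variables (V : finType) (g : rel V) (H : {set {set V}}).
Hypothesis g_sym : symmetric g.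
Hypothesis g_spans : spans g H.
Implicit Types (A B C K U X Y R T N : {set V}) (x y z u v w : V) (m n : nat).
Implicit Types (D : V -> {set V}) (tau : V -> V) (b : V -> {set {set V}}).
Local Notation nd := (nd g H).
Local Notation lnk := (lnk g H).

(* [U] is the set of vertices without owner; the owner of [v] is identified by
   the region [D v] in which it was created, and [tau v] is the core vertex
   that [v] is attached to, through a connected fibre of [tau]. *)
Definition owned U D tau : Prop := forall v, v \notin U ->
  [/\ v \in D v, tau v \notin U, D (tau v) = D v, tau (tau v) = tau v &
      connect (induced g [set u | (u \notin U) && (tau u == tau v)]) v (tau v)].

Lemma absorb U D tau N (good : pred V) :
  owned U D tau -> N \subset U ->
  (forall y, y \notin U -> good y -> N \subset D y) ->
  (forall v, v \in N -> exists q y, [/\ q \in N, y \notin U, good y, g q y &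
     connect (induced g N) v q]) ->
  exists D' tau',
  [/\ forall v, v \notin N -> D' v = D v /\ tau' v = tau v,
      owned (U :\: N) D' tau' &
      forall v, v \in N -> exists q y,
        [/\ q \in N, y \notin U, good y, g q y & connect (induced g N) v q] /\
        (D' v = D y /\ tau' v = tau y)].
Proof.
move=> own /subsetP sNU sND hex.
pose P v y := [exists q in N, [&& y \notin U, good y, g q y & connect (induced g N) v q]].
(* [P v] depends only on the component of [v] in [N], and so does the vertex picked from it. Hence a
   whole component joins one fibre of [tau], which stays connected. On [N] the default is never
   reached ([eP]). *)
pose e v := odflt v [pick y | P v y].
have eP v : v \in N -> P v (e v).
  move=> vN; rewrite /e; case: pickP => [y //|/= h].
  have [q [y [qN yU gy gqy c]]] := hex v vN.
  by have := h y; rewrite /P; case/exists_inP; exists q => //; apply/and4P.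
have eC v v' : v \in N -> connect (induced g N) v v' -> e v = e v'.
  move=> vN c; have : P v =1 P v'.
    move=> y; apply/exists_inP/exists_inP => -[q qN /and4P[h1 h2 h3 h4]];
      exists q; rewrite // h1 h2 h3 /=.
      by apply: connect_trans h4; rewrite conn_sym.
    exact: connect_trans c h4.
  rewrite /e => /eq_pick ->; case: pickP => [//|/= h].
  by have := eP v' (conn_in vN c); rewrite h.
pose D' v := if v \in N then D (e v) else D v.
pose tau' v := if v \in N then tau (e v) else tau v.
have eU v : v \in N -> e v \notin U by move=> /eP/exists_inP[q _ /and4P[]].
have eN v : v \in N -> e v \notin N.
  by move=> vN; apply: contra (eU v vN); apply: sNU.
exists D', tau'; split.
- by move=> v /negPf vN; rewrite /D' /tau' vN.
- move=> v; rewrite in_setD negb_and negbK => vU.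
  have tN w : w \notin U -> tau w \notin N.
    by case/own=> _ tU _ _ _; apply: contra tU; apply: sNU.
  have fib w : w \notin U ->
      connect (induced g [set u | (u \notin U :\: N) && (tau' u == tau w)]) w (tau w).
    move=> wU; have [_ _ _ _] := own w wU; apply: conn_sub.
    apply/subsetP => t; rewrite !inE => /andP[tU tt].
    have tN' : t \notin N by apply: contra tU; apply: sNU.
    by rewrite tN' tU /= /tau' (negPf tN').
  case: (boolP (v \in N)) vU => [vN _|vN /= vU]; last first.
    have [h1 h2 h3 h4 _] := own v vU; have ht := tN v vU.
    rewrite /D' /tau' (negPf vN) (negPf ht) in_setD negb_and h2 orbT.
    by split=> //; have := fib v vU.
  have ev := eU v vN; have [h1 h2 h3 h4 _] := own _ ev; have ht := tN _ ev.
  rewrite /D' /tau' vN (negPf ht) in_setD negb_and h2 orbT; split=> //.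
    case/exists_inP: (eP v vN) => q _ /and4P[_ gd _ _].
    by apply: (subsetP (sND _ ev gd)).
  rewrite -[X in induced _ X]/([set u | (u \notin U :\: N) && (tau' u == tau (e v))]).
  apply: connect_trans (fib _ ev).
  case/exists_inP: (eP v vN) => q qN /and4P[_ gd gq cq].
  have mem t : t \in N -> connect (induced g N) v t ->
      t \in [set u | (u \notin U :\: N) && (tau' u == tau (e v))].
    by move=> tN0 ct; rewrite !inE tN0 /= /tau' tN0 -(eC v t).
  apply: (@connect_trans _ _ q).
    apply: conn_sub (conn_comp vN cq); apply/subsetP => t; rewrite inE => /andP[? ?].
    exact: mem.
  apply: conn_edge => //; first exact: mem.
  by rewrite inE in_setD negb_and ev orbT /= /tau' (negPf (eN v vN)) eqxx.
- move=> v vN; case/exists_inP: (eP v vN) => q qN /and4P[h1 h2 h3 h4].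
  by exists q, (e v); rewrite /D' /tau' vN.
Qed.

Variables (C U0 : {set V}) (D0 : V -> {set V}) (tau0 : V -> V).
Hypothesis C_sub : C \subset U0.
Hypothesis C_closed : forall x y, x \in C -> y \in U0 -> g x y -> y \in C.

(* [v] lies in a piece of a member of [H] inside [C] that touches the owner [R]
   at a vertex anchored in colour [c]. *)
Definition near_owner R (col : V -> bool) (c : bool) : {set V} :=
  [set v in C | [exists A in H, exists k in C, exists y,
    [&& v \in A, k \in A, connect (induced g (A :&: C)) v k, g k y, y \notin U0,
        D0 y == R & col (tau0 y) == c]]].

Lemma near_ownerP R col c v : reflect
  (exists A k y, [/\ A \in H, v \in A :&: C, k \in A :&: C & 
      connect (induced g (A :&: C)) v k] /\
      [/\ g k y, y \notin U0, D0 y = R & col (tau0 y) = c])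
  (v \in near_owner R col c).
Proof.
apply: (iffP idP).
  rewrite inE => /andP[vC /exists_inP[A AH /exists_inP[k kC /existsP[y]]]].
  case/and5P=> vA kA cc gk /and3P[yU /eqP Dy /eqP cy].
  by exists A, k, y; rewrite !inE vC vA kC kA.
case=> A [k [y [[AH /setIP[vA vC] /setIP[kA kC] cc] [gk yU Dy cy]]]].
rewrite inE vC; apply/exists_inP; exists A => //; apply/exists_inP; exists k => //.
by apply/existsP; exists y; rewrite vA kA cc gk yU Dy cy !eqxx.
Qed.

(** Each absorbed vertex has an anchor of colour [c] within [r + 2]: a link, an edge, then the
    radius. Anchors of adjacent absorbed vertices are at distance at most [2 * (r + 2) + 1 < l],
    hence in one block. A component thus stays beside one block and its spread is at most
    [(r + 2) + 2 * l + (r + 2) = 6 * r + 16]. *)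
Lemma near_owner_colour R col r l T (blk : V -> nat) c U D tau :
  {in T &, forall w w', forall n, col w = col w' -> nd R n w w' -> n < l ->
         blk w = blk w'} ->
  {in T &, forall w w', blk w = blk w' -> nd R (2 * l) w w'} ->
  l = 2 * r + 6 -> C \subset R ->
  (forall k y, k \in C -> y \notin U0 -> g k y -> D0 y = R ->
     [/\ y \in R, nd R r y (tau0 y) & tau0 y \in T]) ->
  owned U D tau -> U \subset U0 -> U0 :\: U \subset C ->
  (forall v, v \notin U0 -> D v = D0 v /\ tau v = tau0 v) ->
  (forall v, v \in U0 :\: U -> R \subset D v) ->
  exists U' D' tau',
  [/\ owned U' D' tau', U' = U :\: near_owner R col c,
      forall v, v \notin U -> D' v = D v /\ tau' v = tau v &
      forall v, v \in U :\: U' -> exists q y,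
        [/\ q \in C, v \in C, y \notin U, g q y & nd R (6 * r + 16) v q] /\
        [/\ (y \notin U0 /\ D0 y = R) \/ y \in U0 :\: U, D' v = D y & tau' v = tau y]].
Proof.
move=> blk_col blk_diam el sCR hy own sU /subsetP sUC agr sRD.
set N := near_owner R col c :&: U.
have NC v : v \in N -> v \in C by rewrite !inE => /andP[/andP[]].
(* A component may be cut off from [R] by vertices absorbed earlier; it then joins one of them,
   whose region contains [R]. Indeed the first vertex outside [N] on the way to [R] within the piece
   is near [R] as well, so it has already left [U]. *)
pose good y := ((y \notin U0) && (D0 y == R)) || (y \in U0 :\: U).
have [|y yU gd|v vN|D' [tau' [agr' own' new]]] := @absorb U D tau N good own.
- by apply/subsetP => v /setIP[].
- apply/subsetP => v /NC vC; have vR := subsetP sCR v vC.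
  case/orP: gd => [/andP[yU0 /eqP Dy]|yU0]; first by rewrite (agr y yU0).1 Dy.
  exact: (subsetP (sRD y yU0)).
- case/setIP: (vN) => /near_ownerP[A [k [y [[AH vA kA cc] [gk yU0 Dy cy]]]]] vU.
  have yU : y \notin U by apply: contra yU0; apply: (subsetP sU).
  set N' := [set z in A :&: C | z \in N].
  have sub : N' \subset N by apply/subsetP => z; rewrite inE => /andP[].
  have [ck|nck] := boolP (connect (induced g N') v k).
    exists k, y; split=> //; last exact: conn_sub ck.
      by apply: (subsetP sub); apply: conn_in ck; rewrite inE vA vN.
    by rewrite /good yU0 Dy eqxx.
  have [||u [w [[uA wA cu ncw] [guw _]]]] :=
    @conn_exit _ g _ (fun z => connect (induced g N') v z) _ _ cc => //.
  have uN' : u \in N' by apply: conn_in cu; rewrite inE vA vN.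
  have wN : w \notin N.
    apply: contra ncw => wN; apply: connect_trans cu _; apply: conn_edge => //.
    by rewrite inE wA.
  have sA : N' \subset A :&: C by apply/subsetP => z; rewrite inE => /andP[].
  have wO : w \in near_owner R col c.
    apply/near_ownerP; exists A, k, y; split=> //; split=> //.
    apply: connect_trans cc; rewrite conn_sym //.
    by apply: connect_trans (conn_sub sA cu) _; apply: conn_edge.
  have wU : w \notin U by apply: contra wN => wU; rewrite inE wO.
  exists u, w; split=> //; [exact: (subsetP sub)| |exact: conn_sub cu].
  by case/setIP: wA => _ wC; rewrite /good inE wU (subsetP C_sub w wC) orbT.
have UN : U :\: N = U :\: near_owner R col c.
  by apply/setP => z; rewrite !inE; case: (z \in U); rewrite ?andbF ?andbT.
exists (U :\: near_owner R col c), D', tau'; rewrite -UN; split=> //.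
  by move=> v vU; apply: agr'; apply: contra vU => /setIP[].
move=> v; rewrite in_setD in_setD negb_and negbK => /andP[+ vU].
rewrite vU orbF => vN; have [q [y [[qN yU gd gq cq] [e1 e2]]]] := new v vN.
exists q, y; split; last first.
  by split=> //; case/orP: gd => [/andP[? /eqP ?]|?]; [left|right].
split=> //; try exact: NC.
have wit z : z \in N -> exists y, [/\ nd R (r + 2) z (tau0 y), col (tau0 y) = c & tau0 y \in T].
  case/setIP=> /near_ownerP[A [k [y0 [[AH zA kA cc] [gk yU0 Dy cy]]]]] _.
  have kC : k \in C by case/setIP: kA.
  have [yR ny yT] := hy k y0 kC yU0 gk Dy; exists y0; split=> //.
  have l1 : lnk R z k.
    apply: lnk_piece AH _ _ zA cc; first exact: subsetIl.
    exact: subset_trans (subsetIr _ _) sCR.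
  have l2 : lnk R k y0 by apply: lnk_edge => //; apply: (subsetP sCR).
  by have := nd_trans (nd_trans (nd_lnk l1) (nd_lnk l2)) ny; rewrite addnC.
pose W z t := exists y, [/\ nd R (r + 2) z (tau0 y), col (tau0 y) = c, tau0 y \in T & blk (tau0 y) = t].
have [yv [nv cv Tv]] := wit v vN; set t0 := blk (tau0 yv).
have step z z' t : W z t -> z' \in N -> nd R 1 z z' -> W z' t.
  case=> y1 [n1 c1 T1 b1] z'N d; have [y2 [n2 c2 T2]] := wit z' z'N.
  exists y2; split=> //; rewrite -b1; apply: blk_col T2 T1 ((r + 2) + 1 + (r + 2)) _ _ _.
  - by rewrite c1 c2.
  - apply: nd_trans n1; apply: nd_trans (nd_symm g_sym d).
    by apply: nd_symm.
  - by rewrite el; clear; lia.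
have Wq : W q t0.
  case/connectP: cq => p pp ->; have Wv : W v t0 by exists yv.
  move: pp Wv vN; clearbody t0; move: {vU nv cv Tv e1 e2} v.
  elim: p => [|z p IH] x //= /andP[/and3P[_ zN gxz] pz] Wx xN.
  apply: (IH z pz) => //; apply: (step _ _ _ Wx zN); apply: nd_lnk.
  exact: (lnk_edge g_spans (subsetP sCR _ (NC _ xN)) (subsetP sCR _ (NC _ zN)) gxz).
have [y' [n' c' T' b']] := Wq; have d := blk_diam _ _ Tv T' (esym b').
apply: nd_leq (nd_trans (nd_trans nv d) (nd_symm g_sym n')).
by rewrite el; clear; lia.
Qed.

End Absorb.

(** * The invariant of the process and its two steps *)

Section Process.
Variables (V : finType) (g : rel V) (H : {set {set V}}).
Hypothesis g_sym : symmetric g.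
Hypothesis g_spans : spans g H.
Implicit Types (A B C K U X Y R T N : {set V}) (x y z u v w : V) (m n p q : nat).
Implicit Types (D : V -> {set V}) (tau : V -> V) (b : V -> {set {set V}}).
Implicit Types (S : {set {set V}}).
Local Notation nd := (nd g H).
Local Notation lnk := (lnk g H).
Local Notation owned := (owned g).
Local Notation core := (core g H).

Definition conn K : Prop := {in K &, forall x y, connect (induced g K) x y}.

Definition reg U u : {set V} := [set x in U | connect (induced g U) u x].

Lemma reg_self U u : u \in U -> u \in reg U u.
Proof. by move=> uU; rewrite inE uU connect0. Qed.

Lemma reg_subU U u : reg U u \subset U.
Proof. by apply/subsetP => x; rewrite inE => /andP[]. Qed.

Lemma reg_eq U u x : x \in reg U u -> reg U x = reg U u.
Proof.
rewrite inE => /andP[xU c]; apply/setP => y; rewrite !inE; congr (_ && _).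
by rewrite (same_connect (conn_sym g_sym U) c).
Qed.

Lemma reg_conn U u : u \in U -> conn (reg U u).
Proof.
move=> uU x y; rewrite !inE => /andP[xU cx] /andP[yU cy].
by apply: connect_trans (conn_comp uU cy); rewrite conn_sym //; apply: conn_comp.
Qed.

Lemma reg_closed U u x y : x \in reg U u -> y \in U -> g x y -> y \in reg U u.
Proof.
rewrite !inE => /andP[xU cx] yU gxy; rewrite yU; apply: connect_trans cx _.
exact: conn_edge.
Qed.

Lemma reg_max U u K : conn K -> K \subset U -> u \in K -> K \subset reg U u.
Proof.
move=> cK sK uK; apply/subsetP => x xK; rewrite inE (subsetP sK) //=.
by apply: conn_sub sK _; apply: cK.
Qed.

Lemma reg_sub U U' u : U' \subset U -> u \in U' -> reg U' u \subset reg U u.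
Proof.
move=> sU uU; apply: reg_max; [exact: reg_conn | | exact: reg_self].
exact: subset_trans (reg_subU _ _) sU.
Qed.

(* An owner is older than another one if its region is larger. *)
Definition depth S R := #|[set Y in S | R \proper Y]|.

Lemma depth_sub S S' R : S \subset S' -> depth S R <= depth S' R.
Proof.
move=> /subsetP s; apply: subset_leq_card; apply/subsetP => Y.
by rewrite !inE => /andP[/s -> ->].
Qed.

(** The radius granted to an owner with [p] older owners in the bag. The values are solved backwards
    from 0, so that an owner of depth [d] can pay all increments of one shaving round when its depth
    drops ([rho_rad]): 34 <= 40, 588 <= 600 and 8382 <= 8400. *)
Definition rad p := if p is p'.+1 then (if p' is p''.+1 then
  (if p'' is _.+1 then 0 else 40) else 600) else 8400.

Lemma rad_mono p q : p <= q -> rad q <= rad p.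
Proof. by case: p => [|[|[|p]]]; case: q => [|[|[|q]]]. Qed.

Definition K5_minor : Prop := exists F : 'I_5 -> {set V},
  [/\ forall i, F i != set0 /\ conn (F i),
      forall i j, i != j -> [disjoint F i & F j] &
      forall i j, i != j -> exists x y, [/\ x \in F i, y \in F j & g x y]].

(** Among the owners existing now, those that own [x] or may still come to own it. *)
Definition pot U D b x R := if x \in U then R \in b x else D x == R.

Definition small K := [exists A in H, K \subset A].

Definition cores U D tau R : {set V} :=
  [set w | [&& w \notin U, tau w == w & D w == R]].

(** [i_rad] is the final estimate, while [i_bd] is the sharper one on the frontier, where absorption
    still goes on. [i_touch] makes the owners of a bag pairwise adjacent for the clique minor.
    [i_lam] and [i_edge] provide a largest region among the owners met by a connected set. [i_J] is
    what permits a bag of bounded size to control all members of [H]. *)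
Record stage U D tau b : Prop := Inv {
  i_own : owned U D tau;
  i_rad : forall v, v \notin U -> nd (D v) 8400 v (tau v);
  i_core : forall v, v \notin U ->
    core (D v) (cores U D tau (D v)) /\ conn (cores U D tau (D v));
  i_bag : forall u R, u \in U -> R \in b u ->
    reg U u \subset R /\ exists2 v, v \notin U & D v = R;
  i_card : forall u, u \in U -> #|b u| <= 4;
  i_cst : forall u u', u \in U -> u' \in U -> g u u' -> b u = b u';
  i_bd : forall u v, u \in U -> v \notin U -> g u v ->
    D v \in b u /\ nd (D v) (rad (depth (b u) (D v))) v (tau v);
  (* The oldest owner that can ever meet [K] is in the bag of [u]. *)
  i_J : forall u K R, u \in U -> conn K -> small K -> u \in K ->
    ~~ (K \subset reg U u) -> K \subset R ->
    (forall x, x \in K -> x \notin U -> D x \subset R) ->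
    (exists2 x, x \in K & pot U D b x R) -> R \in b u;
  i_touch : forall u R R', u \in U -> R \in b u -> R' \in b u -> R != R' ->
    exists x y, [/\ x \notin U, y \notin U, D x = R, D y = R' & g x y];
  i_lam : forall v v', v \notin U -> v' \notin U ->
    [|| [disjoint D v & D v'], D v \subset D v' | D v' \subset D v];
  i_edge : forall v v', v \notin U -> v' \notin U -> g v v' ->
    (D v \subset D v') || (D v' \subset D v);
  i_reg : forall v u, v \notin U -> u \in U -> u \in D v -> reg U u \subset D v
}.

Section Step.
Variables (U : {set V}) (D : V -> {set V}) (tau : V -> V) (b : V -> {set {set V}}).
Hypothesis I : stage U D tau b.
Variable u0 : V.
Hypothesis u0U : u0 \in U.
Let C := reg U u0.
Let B := b u0.

Let CU : C \subset U. Proof. exact: reg_subU. Qed.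
Let u0C : u0 \in C. Proof. exact: reg_self. Qed.
Let C_closed x y : x \in C -> y \in U -> g x y -> y \in C.
Proof. exact: reg_closed. Qed.
Let inCU x : x \in C -> x \in U. Proof. exact: (subsetP CU). Qed.

Lemma bag_const x : x \in C -> b x = B.
Proof.
rewrite inE => /andP[xU /connectP[p pp ->]]; rewrite /B.
elim: p u0 u0U pp => [|z p IH] y yU //= /andP[/and3P[_ zU gyz] pz].
by rewrite (IH z zU pz) (i_cst I yU zU gyz).
Qed.

Lemma bag_chain R R' : R \in B -> R' \in B -> (R \subset R') || (R' \subset R).
Proof.
move=> RB RB'; have [s1 [v vU e]] := i_bag I u0U RB.
have [s2 [v' vU' e']] := i_bag I u0U RB'.
have := i_lam I vU vU'; rewrite e e' => /or3P[dis|->//|->]; last by rewrite orbT.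
have := disjointFr dis (subsetP s1 _ u0C); by rewrite (subsetP s2 _ u0C).
Qed.

Lemma bag_notin R : R \in B -> ~~ (R \subset U).
Proof.
move=> RB; have [_ [v vU e]] := i_bag I u0U RB.
apply/subsetPn; exists v => //; rewrite -e.
by have [] := i_own I vU.
Qed.

Lemma C_sub_bag R : R \in B -> C \subset R.
Proof. by move=> RB; have [] := i_bag I u0U RB. Qed.

Definition abut : {set {set V}} :=
  [set R | [exists x in C, exists y, [&& y \notin U, g x y & D y == R]]].

Lemma abutP R : reflect (exists x y, [/\ x \in C, y \notin U, g x y & D y = R]) (R \in abut).
Proof.
rewrite inE; apply: (iffP exists_inP).
  by case=> x xC /existsP[y /and3P[yU gxy /eqP e]]; exists x, y.
by case=> x [y [xC yU gxy e]]; exists x => //; apply/existsP; exists y; rewrite yU gxy e eqxx.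
Qed.

Lemma abut_sub : abut \subset B.
Proof.
apply/subsetP => R /abutP[x [y [xC yU gxy <-]]].
by have [] := i_bd I (inCU xC) yU gxy; rewrite bag_const.
Qed.

(** Forgetting a cut-off owner can break [i_J] only for pieces that leave [C] at a younger owner.
    These younger bordering owners are the ones that have to absorb, and they also gain in rank. *)
Definition targets : {set {set V}} :=
  [set W in abut | [exists Y in B :\: abut, W \proper Y]].

Lemma targets_sub : targets \subset abut.
Proof. by apply/subsetP => W; rewrite inE => /andP[]. Qed.

Lemma target_bag R : R \in targets -> R \in B.
Proof. by move=> /(subsetP targets_sub)/(subsetP abut_sub). Qed.

Definition near R : {set V} := near_owner g H C U D tau R (fun _ => true) true.

(** One pass per colour; a pass costs the spread [6 * rad p + 16] of a component and one edge. *)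
Definition inc p := 2 * (6 * rad p + 17).
(** The radius of [R] once the owners of depth below [p] have had their turn. The neighbourhood of
    an owner may be attached to an older one, so [R] is charged for its own turn and for those of
    all younger owners so far. *)
Definition rho R p := rad (depth B R) + \sum_(q < p | depth B R <= q) inc q.

Lemma rhoS R p : depth B R <= p -> rho R p.+1 = rho R p + inc p.
Proof. by move=> h; rewrite /rho big_mkcond big_ord_recr -big_mkcond /= h addnA. Qed.

Lemma rhoS_le R p : rho R p <= rho R p.+1.
Proof.
by rewrite /rho [X in _ <= _ + X]big_mkcond big_ord_recr -big_mkcond /= leq_add2l leq_addr.
Qed.

Lemma depth_lt R : R \in B -> depth B R < 4.
Proof.
move=> RB; apply: leq_trans (i_card I u0U); apply: proper_card.
apply/properP; split; first by apply/subsetP => Y; rewrite inE => /andP[].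
by exists R => //; rewrite inE properxx andbF.
Qed.

Lemma depth_anti R R' : R \in B -> R' \in B -> depth B R' < depth B R -> R \subset R'.
Proof.
move=> RB RB' h; case/orP: (bag_chain RB RB') => // s.
move: h; rewrite ltnNge; case/negP; apply: subset_leq_card.
apply/subsetP => Y; rewrite !inE => /andP[-> /=]; exact: sub_proper_trans.
Qed.

Lemma depth_inj R R' : R \in B -> R' \in B -> depth B R' = depth B R -> R = R'.
Proof.
move=> RB RB' h; apply/eqP; apply: contraT => ne.
wlog s : R R' RB RB' h ne / R \subset R'.
  case/orP: (bag_chain RB RB') => s W; first exact: W s.
  by apply: (W R' R) => //; rewrite eq_sym.
have pr : R \proper R' by rewrite properEneq ne.
suff : depth B R' < depth B R by rewrite h ltnn.
apply: proper_card; apply/properP; split.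
  by apply/subsetP => Y; rewrite !inE => /andP[-> /=]; apply: proper_trans.
by exists R'; rewrite !inE ?RB' ?pr // properxx andbF.
Qed.

(** This drop of the depth is what pays for the growth of the radius: an older owner than [R] is
    about to leave the bag. *)
Lemma target_depth R : R \in targets -> depth abut R < depth B R.
Proof.
rewrite in_set => /andP[RA /exists_inP[Y /setDP[YB YA] pr]]; apply: proper_card.
apply/properP; split.
  by apply/subsetP => Z; rewrite in_set => /andP[/(subsetP abut_sub) h1 h2]; rewrite in_set h1.
exists Y; first by rewrite in_set YB pr.
by rewrite in_set negb_and YA.
Qed.

Lemma rho_rad R : R \in targets -> rho R 4 <= rad (depth abut R).
Proof.
move=> Rt; have h1 := target_depth Rt; have h2 := depth_lt (target_bag Rt).
suff h : rho R 4 <= rad (depth B R).-1.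
  by apply: leq_trans h _; apply: rad_mono; move: h1; clear; lia.
rewrite /rho !big_mkcond /= !big_ord_recr big_ord0 /=.
by move: h1 h2; case: (depth B R) => [|[|[|[|?]]]].
Qed.

(* Owners absorb their neighbourhood in C one after the other, the oldest first:
   then every component is attached to an owner at least as old as its label. *)
Lemma shave_loop p : p <= 4 -> exists U' D' tau',
  [/\ owned U' D' tau', U' = U :\: \bigcup_(R in targets | depth B R < p) near R,
      forall v, v \notin U -> D' v = D v /\ tau' v = tau v &
      forall v, v \in U :\: U' ->
        [/\ v \in C, D' v \in targets, depth B (D' v) < p, tau' v \notin U &
            nd (D' v) (rho (D' v) p) v (tau' v)]].
Proof.
elim: p => [_|p IH hp].
  exists U, D, tau; split=> //; first exact: i_own I.
    by rewrite big_pred0 ?setD0 // => R; rewrite andbF.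
  by move=> v; rewrite setDv inE.
have [U1 [D1 [tau1 [own1 eU1 agr1 new1]]]] := IH (ltnW hp).
have [/existsP[R /andP[Rt /eqP Rp]]|nR] := boolP [exists R, (R \in targets) && (depth B R == p)];
  last first.
  exists U1, D1, tau1; split=> //.
    rewrite eU1; congr (_ :\: _); apply: eq_bigl => R; case: (boolP (R \in targets)) => //= Rt.
    rewrite [in RHS]ltnS [in RHS]leq_eqVlt; case: eqP => // e; case/negP: nR.
    by apply/existsP; exists R; rewrite Rt e eqxx.
  move=> v /new1[h1 h2 h3 h4 h5]; split=> //; first exact: ltnW.
  exact: nd_leq (rhoS_le _ _) h5.
have RB := target_bag Rt; set r := rad p.
have [v0 v0U eR] := (i_bag I u0U RB).2.
have [cR _] := i_core I v0U; rewrite eR in cR.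
have l0 : 0 < 2 * r + 6 by rewrite addnS.
have [blk [col [b1 b2 _ _]]] := cR _ l0.
have hy k y : k \in C -> y \notin U -> g k y -> D y = R ->
    [/\ y \in R, nd R r y (tau y) & tau y \in cores U D tau R].
  move=> kC yU gky Dy; have [h1 h2 h3 h4 _] := i_own I yU.
  have [_ h5] := i_bd I (inCU kC) yU gky; rewrite bag_const // Dy Rp in h5.
  by rewrite -{1}Dy h1 h5 inE h2 h3 h4 Dy !eqxx.
have colstep c Ua Da taua (h : {set V} -> nat) : owned Ua Da taua -> Ua \subset U ->
    (forall v, v \notin U -> Da v = D v /\ taua v = tau v) ->
    (forall X, X \in targets -> r <= h R) ->
    (forall v, v \in U :\: Ua ->
        [/\ v \in C, Da v \in targets, depth B (Da v) < p.+1, taua v \notin U &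
            nd (Da v) (h (Da v)) v (taua v)]) ->
    exists Ub Db taub, 
     [/\ owned Ub Db taub, Ub = Ua :\: near_owner g H C U D tau R col c,
     forall v, v \notin U -> Db v = D v /\ taub v = tau v &
     forall v, v \in U :\: Ub ->
        [/\ v \in C, Db v \in targets, depth B (Db v) < p.+1, taub v \notin U &
            nd (Db v) (h (Db v) + (6 * r + 17)) v (taub v)]].
  move=> owna sUa agra hr newa.
  have RD v : v \in U :\: Ua -> R \subset Da v.
    move=> /newa[_ h2 h3 _ _]; move: h3; rewrite ltnS leq_eqVlt => /orP[/eqP e|lt].
      by rewrite (depth_inj (R := R) (R' := Da v)) // ?(target_bag h2) // e Rp.
    by apply: depth_anti; rewrite // ?(target_bag h2) // Rp.
  have sC : U :\: Ua \subset C by apply/subsetP => v /newa[].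
  have [Ub [Db [taub [ownb eUb agrb newb]]]] := near_owner_colour g_sym g_spans CU c
    b1 b2 erefl (C_sub_bag RB) hy owna sUa sC agra RD.
  exists Ub, Db, taub; split=> //.
    move=> v vU; have [e1 e2] := agra v vU.
    by have [-> ->] := agrb v (contra (subsetP sUa v) vU).
  move=> v /setDP[vU vUb].
  case: (boolP (v \in Ua)) => [vUa|vUa]; last first.
    have [->  ->] := agrb v vUa.
    have [h1 h2 h3 h4 h5] := newa v (introT setDP (conj vU vUa)).
    by split=> //; apply: nd_leq h5; rewrite leq_addr.
  have [q [y [[qC vC yUa gqy nvq] [hyy -> ->]]]] := newb v (introT setDP (conj vUa vUb)).
  have [yD _ _ _ _] := owna y yUa.
  case: hyy => [[yU Dy]|yU].
    have [yR ny _] := hy q y qC yU gqy Dy; have [-> ->] := agra y yU.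
    rewrite Dy Rp ltnSn; split=> //; first by have [_ h2 _ _ _] := i_own I yU.
    have l1 : lnk R q y by apply: (lnk_edge g_spans) => //; apply: (subsetP (C_sub_bag RB)).
    apply: nd_leq (nd_trans (nd_trans nvq (nd_lnk l1)) ny).
    by have := hr R Rt; clear; lia.
  have [h1 h2 h3 h4 h5] := newa y yU; split=> //.
  have sR := RD y yU.
  have l1 : lnk (Da y) q y.
    by apply: (lnk_edge g_spans) => //; apply: (subsetP sR); apply: (subsetP (C_sub_bag RB)).
  apply: nd_leq (nd_trans (nd_trans (nd_sub sR nvq) (nd_lnk l1)) h5).
  by clear; lia.
have sU1 : U1 \subset U by rewrite eU1 subsetDl.
have hr0 X : X \in targets -> r <= rho R p by move=> _; rewrite /rho Rp leq_addr.
have [|Ua [Da [taua [owna eUa agra newa]]]] := colstep false U1 D1 tau1 (rho^~ p) own1 sU1 agr1 hr0.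
  by move=> v /new1[h1 h2 h3 h4 h5]; split=> //; apply: ltnW.
have sUa : Ua \subset U by rewrite eUa; apply: subset_trans (subsetDl _ _) sU1.
have hr1 X : X \in targets -> r <= rho R p + (6 * r + 17).
  by move=> Xt; apply: leq_trans (hr0 X Xt) (leq_addr _ _).
have [Ub [Db [taub [ownb eUb agrb newb]]]] :=
  colstep true Ua Da taua (fun X => rho X p + (6 * r + 17)) owna sUa agra hr1 newa.
exists Ub, Db, taub; split=> //; last first.
  move=> v /newb[h1 h2 h3 h4 h5]; split=> //; apply: nd_leq h5.
  by rewrite rhoS // /inc -/r; clear; lia.
have nearE : near R = near_owner g H C U D tau R col false :|: near_owner g H C U D tau R col true.
  apply/setP => v; rewrite in_setU; apply/near_ownerP/orP.
    case=> A [k [y [h1 [h2 h3 h4 _]]]].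
    by case: (boolP (col (tau y))) => cy; [right|left]; apply/near_ownerP;
      exists A, k, y; split=> //; split=> //; apply: negbTE.
  by case=> /near_ownerP[A [k [y [h1 [h2 h3 h4 _]]]]]; exists A, k, y.
rewrite eUb eUa eU1 !setDDl -nearE; congr (_ :\: _).
rewrite [RHS](bigD1 R) /=; last by rewrite Rt Rp ltnS leqnn.
rewrite setUC; congr (_ :|: _).
apply: eq_bigl => X; case: (boolP (X \in targets)) => //= Xt.
rewrite [in RHS]ltnS [in RHS]leq_eqVlt; case: eqP => [e|ne] /=.
  rewrite e ltnn; apply/esym/negbTE; rewrite negbK; apply/eqP.
  by apply: depth_inj; rewrite ?Rp // (target_bag Xt).
case: ltnP => //= lt; apply/esym/eqP => eX; by apply: ne; rewrite eX Rp.
Qed.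

(** One format for both steps, so that [step_completes] treats them in a single argument. *)
Definition step_ok (birth : bool) U' D' tau' b' : Prop :=
  [/\ stage U' D' tau' b', U' \subset U, forall v, v \notin U -> D' v = D v,
      forall v, v \in U :\: U' -> v \in C /\ (if birth then D' v = C else D' v \in B) &
      forall u, u \in U' ->
        b' u \subset (if u \in C then (if birth then C |: B else B) else b u)].

Lemma reg_far U' u : U' \subset U -> U :\: C \subset U' -> u \in U :\: C ->
  reg U' u = reg U u.
Proof.
move=> sU sC /setDP[uU uC].
have uU' : u \in U' by apply: (subsetP sC); rewrite inE uC.
apply/eqP; rewrite eqEsubset reg_sub //=; apply: reg_max; [exact: reg_conn| |exact: reg_self].
apply/subsetP => x xr; apply: (subsetP sC); rewrite inE (subsetP (reg_subU _ _) _ xr) andbT.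
by apply: contra uC => /reg_eq; rewrite (reg_eq xr) -/C => <-; apply: reg_self.
Qed.

Lemma leave_C K u : conn K -> u \in K -> u \in C -> ~~ (K \subset C) ->
  exists x y, [/\ x \in reg (K :&: C) u, x \in C, y \in K, y \notin U & g x y].
Proof.
move=> cK uK uC /subsetPn[z zK zC].
have uKC : u \in K :&: C by rewrite inE uK.
have [||x [y [[xK yK xr yr] [gxy _]]]] :=
  @conn_exit _ g _ (fun t => t \in reg (K :&: C) u) _ _ (cK u z uK zK).
- exact: reg_self.
- by apply: contra zC => /(subsetP (reg_subU _ _))/setIP[].
have xC : x \in C by move/(subsetP (reg_subU _ _))/setIP: xr => [].
exists x, y; split=> //; apply: contra yr => yU.
have yC := C_closed xC yU gxy.
by apply: (reg_closed xr _ gxy); rewrite inE yK.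
Qed.

(** What remains of [C] is free of vertices near a target, so the bag can shrink to [abut]. If
    nothing was absorbed, the total size of the bags still drops; together with the size of [U] this
    gives the lexicographic measure of [complete]. *)
Lemma shave : ~~ (B \subset abut) -> exists U' D' tau' b',
  step_ok false U' D' tau' b' /\
  (#|U'| < #|U| \/ U' = U /\ \sum_(u in U) #|b' u| < \sum_(u in U) #|b u|).
Proof.
move=> nadj; have [U' [D' [tau' [own eU agr new]]]] := shave_loop (leqnn 4).
have sU : U' \subset U by rewrite eU subsetDl.
have nU v : v \notin U -> v \notin U' by apply: contra; apply: (subsetP sU).
have agD v : v \notin U -> D' v = D v by move=> /agr[].
have new' v : v \in U -> v \notin U' ->
   [/\ v \in C, D' v \in targets, tau' v \notin U & nd (D' v) (rho (D' v) 4) v (tau' v)].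
  by move=> vU vU'; have [|? ? _ ? ?] := new v; first by rewrite inE vU'.
have far : U :\: C \subset U'.
  apply/subsetP => x /setDP[xU xC]; apply: contraT => xU'.
  by have [] := new' x xU xU'; rewrite (negPf xC).
have notnear u R : u \in U' -> R \in targets -> u \notin near R.
  move=> uU' Rt; move: uU'; rewrite eU => /setDP[_]; apply: contra => h.
  by apply/bigcupP; exists R; rewrite // Rt depth_lt // target_bag.
have domOld v : v \notin U' -> exists2 v0, v0 \notin U & D' v = D v0.
  move=> vU'; case: (boolP (v \in U)) => vU; last by exists v => //; apply: agD.
  have [_ h _ _] := new' v vU vU'; have [_ [v0 ? e]] := i_bag I u0U (target_bag h).
  by exists v0.
have coresE R : cores U' D' tau' R = cores U D tau R.
  apply/setP => w; rewrite !inE; case: (boolP (w \in U)) => wU /=; last first.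
    by rewrite (nU _ wU); have [-> ->] := agr w wU.
  apply/negbTE; apply/negP => /and3P[wU' /eqP tw _].
  by have [_ _ + _] := new' w wU wU'; rewrite tw wU.
pose b' v := if v \in C then abut else b v.
have CC u v : u \in U -> v \in U -> g u v -> (u \in C) = (v \in C).
  move=> uU vU guv; apply/idP/idP => h; first exact: C_closed guv.
  by apply: C_closed h uU _; rewrite g_sym.
have inv' : stage U' D' tau' b'.
  split=> //.
  - move=> v vU'; case: (boolP (v \in U)) => vU; last first.
      by have [-> ->] := agr v vU; apply: i_rad I _ vU.
    have [_ h _ d] := new' v vU vU'; apply: nd_leq d.
    exact: leq_trans (rho_rad h) (rad_mono (leq0n _)).
  - by move=> v /domOld[v0 v0U ->]; rewrite coresE; apply: i_core I _ v0U.
  - move=> u R uU'; have uU := subsetP sU u uU'; rewrite /b'.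
    have sr := reg_sub sU uU'.
    have aux S : S \subset b u -> R \in S -> reg U' u \subset R /\ exists2 v, v \notin U' & D' v = R.
      move=> sS RS; have [h [v vU e]] := i_bag I uU (subsetP sS R RS).
      split; first exact: subset_trans h.
      by exists v; rewrite ?agD // nU.
    by case: ifP => uC; apply: aux; rewrite // bag_const // abut_sub.
  - move=> u uU'; rewrite /b'; case: ifP => uC; last exact: i_card I _ (subsetP sU u uU').
    exact: leq_trans (subset_leq_card abut_sub) (i_card I u0U).
  - move=> u u' /(subsetP sU) uU /(subsetP sU) uU' guu.
    by rewrite /b' (CC u u') //; case: ifP => // _; apply: i_cst I _ _ _ _ guu.
  - move=> u v uU' vU' guv; have uU := subsetP sU u uU'.
    case: (boolP (v \in U)) => vU; last first.
      have [-> ->] := agr v vU; have [h1 h2] := i_bd I uU vU guv.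
      rewrite /b'; case: ifP => uC //; split; first by apply/abutP; exists u, v.
      apply: nd_leq h2; rewrite bag_const //; apply: rad_mono; exact: depth_sub abut_sub.
    have [vC vt _ d] := new' v vU vU'; rewrite /b' (CC u v) // vC.
    by split; [exact: (subsetP targets_sub) | exact: nd_leq (rho_rad vt) d].
  - move=> u K R uU' cK sK uK nK KR own' [x xK px].
    have uU := subsetP sU u uU'; rewrite /b'.
    have potB : x \in C -> R \in abut.
      move=> xC; move: px; rewrite /pot /b' xC; case: ifP => [//|xU'] /eqP <-.
      have [_ h _ _] := new' x (inCU xC) (negbT xU'); exact: (subsetP targets_sub).
    have px' : pot U D b x R.
      rewrite /pot; case: ifP => xU.
        case: (boolP (x \in C)) => xC.
          by rewrite bag_const // (subsetP abut_sub) // potB.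
        have xU' : x \in U' by apply: (subsetP far); rewrite inE xC.
        by move: px; rewrite /pot /b' xU' (negPf xC).
      by move: px; rewrite /pot (negPf (nU _ (negbT xU))) agD // xU.
    have ownO y : y \in K -> y \notin U -> D y \subset R.
      by move=> yK yU; rewrite -agD //; apply: own' => //; apply: nU.
    case: ifP => uC; last first.
      apply: (i_J I uU cK sK uK _ KR ownO); last by exists x.
      by rewrite -(reg_far sU far) // inE uC.
    case: (boolP (K \subset C)) => KC; first exact: potB (subsetP KC x xK).
    have nKr : ~~ (K \subset reg U u) by rewrite (reg_eq uC).
    have RB : R \in B.
      by rewrite -(bag_const uC); apply: (i_J I uU cK sK uK nKr KR ownO); exists x.
    (* If [R] were cut off, [K] would leave [C] at a vertex [y] whose owner lies properly inside [R]
       and hence is a target. The part of [K] from [u] to the exit lies in one piece, so [u] would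
       have been absorbed. *)
    apply: contraT => Radj; have [k [y [kr kC yK yU gky]]] := leave_C cK uK uC KC.
    have yadj : D y \in abut by apply/abutP; exists k, y.
    have yt : D y \in targets.
      rewrite in_set yadj; apply/exists_inP; exists R; first by rewrite in_setD Radj RB.
      rewrite properEneq ownO // andbT; apply: contraNneq Radj => <-; exact: yadj.
    case/negP: (notnear u (D y) uU' yt).
    case/exists_inP: sK => A AH KA; apply/near_ownerP; exists A, k, y; split; last by [].
    have uKC : u \in K :&: C by rewrite inE uK.
    have sub : reg (K :&: C) u \subset A :&: C.
      by apply: subset_trans (reg_subU _ _) _; apply: setSI.
    split=> //; [exact: (subsetP sub _ (reg_self uKC)) | exact: (subsetP sub) |].
    by apply: conn_sub sub _; apply: reg_conn => //; apply: reg_self.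
  - move=> u R R' uU' Rb Rb' ne; have uU := subsetP sU u uU'.
    have sb : b' u \subset b u by rewrite /b'; case: ifP => // uC; rewrite bag_const // abut_sub.
    have [x [y [xU yU <- <- gxy]]] := i_touch I uU (subsetP sb _ Rb) (subsetP sb _ Rb') ne.
    by exists x, y; rewrite !agD // !nU.
  - move=> v v' /domOld[v0 h0 ->] /domOld[v1 h1 ->]; exact: i_lam I _ _ h0 h1.
  - move=> v v' vU' vU'' gvv.
    have inB x y : x \in U -> x \notin U' -> y \notin U' -> g x y -> D' y \in B.
      move=> xU xU' yU' gxy; have [xC _ _ _] := new' x xU xU'.
      case: (boolP (y \in U)) => yU.
        by have [_ h _ _] := new' y yU yU'; apply: target_bag.
      by rewrite agD // -(bag_const xC); have [] := i_bd I xU yU gxy.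
    have inB' x : x \in U -> x \notin U' -> D' x \in B.
      by move=> xU xU'; have [_ h _ _] := new' x xU xU'; apply: target_bag.
    case: (boolP (v \in U)) => vU.
      by apply: bag_chain; [exact: inB' | exact: inB gvv].
    case: (boolP (v' \in U)) => v'U.
      by apply: bag_chain; [apply: inB v'U vU'' vU' _; rewrite g_sym | exact: inB'].
    by rewrite !agD //; apply: i_edge I _ _ _ _ gvv.
  - move=> v u /domOld[v0 h0 ->] uU' uD; have uU := subsetP sU u uU'.
    exact: subset_trans (reg_sub sU uU') (i_reg I h0 uU uD).
exists U', D', tau', b'; split.
  split=> // [v /setDP[vU vU']|u uU'].
    by have [vC h _ _] := new' v vU vU'; split=> //; apply: target_bag.
  by rewrite /b'; case: ifP => // uC; apply: abut_sub.
have := subset_leq_card sU; rewrite leq_eqVlt => /orP[/eqP e|]; [right|by left].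
have eUU : U' = U by apply/eqP; rewrite eqEcard sU e leqnn.
split=> //; rewrite (bigD1 u0) //= [X in _ < X](bigD1 u0) //=.
have lt : #|b' u0| < #|b u0|.
  by rewrite /b' u0C -/B; apply: proper_card; rewrite properE abut_sub nadj.
rewrite -addSn; apply: leq_add => //; apply: leq_sum => v /andP[vU _].
by rewrite /b'; case: ifP => // vC; rewrite bag_const // subset_leq_card // abut_sub.
Qed.

Definition owner R : {set V} := [set v | (v \notin U) && (D v == R)].

Lemma owner_conn R : conn (owner R).
Proof.
have toT v : v \in owner R -> connect (induced g (owner R)) v (tau v) /\ tau v \in cores U D tau R.
  rewrite inE => /andP[vU /eqP e]; have [h1 h2 h3 h4 h5] := i_own I vU.
  rewrite inE h2 h3 h4 e !eqxx; split=> //; apply: conn_sub h5.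
  apply/subsetP => w; rewrite !inE => /andP[wU /eqP tw]; rewrite wU /=.
  by have [_ _ <- _ _] := i_own I wU; rewrite tw h3 e.
move=> x y xO yO; have [cx tx] := toT x xO; have [cy ty] := toT y yO.
apply: connect_trans cx _; rewrite conn_sym //; apply: connect_trans cy _; rewrite conn_sym //.
move: (xO); rewrite inE => /andP[xU /eqP e]; have [_ cc] := i_core I xU.
rewrite e in cc; apply: conn_sub (cc _ _ tx ty); apply/subsetP => w.
by rewrite !inE => /and3P[-> _ ->].
Qed.

Lemma bag_small : ~ K5_minor -> B \subset abut -> #|B| <= 3.
Proof.
move=> nK sB; rewrite leqNgt; apply/negP => h4; apply: nK.
pose s := enum B; have szs : 3 < size s by rewrite -cardE.
pose r i := nth set0 s i.
have rB (i : nat) : i < 4 -> r i \in B.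
  by move=> i4; rewrite -mem_enum; apply: mem_nth; apply: leq_trans szs.
have rne (i j : nat) : i < 4 -> j < 4 -> i != j -> r i != r j.
  by move=> i4 j4 ne; rewrite nth_uniq ?enum_uniq //; apply: leq_trans szs.
pose F (i : 'I_5) := if i < 4 then owner (r i) else C.
have E (i : 'I_5) : ~~ (i < 4) -> i = ord_max.
  by move=> h; apply: val_inj => /=; move: (ltn_ord i) h; clear; lia.
have OC R : [disjoint owner R & C].
  rewrite -setI_eq0; apply/eqP/setP => v; rewrite !inE; apply/negbTE/negP.
  by case/andP=> /andP[vU _] /andP[/idPn]; rewrite vU.
have tC (i : nat) : i < 4 -> exists x y, [/\ x \in owner (r i), y \in C & g x y].
  move=> /rB/(subsetP sB)/abutP[x [y [xC yU gxy e]]].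
  by exists y, x; rewrite g_sym gxy xC inE yU e eqxx.
exists F; split.
- move=> i; rewrite /F; case: ifP => i4; last first.
    by split; [apply/set0Pn; exists u0 | exact: reg_conn].
  split; last exact: owner_conn.
  have [x [y [xO _ _]]] := tC i i4; by apply/set0Pn; exists x.
- move=> i j ne; rewrite /F; case: ifPn => i4; case: ifPn => j4 //.
  + rewrite -setI_eq0; apply/eqP/setP => v; rewrite !inE; apply/negbTE/negP.
    case/andP=> /andP[_ /eqP e1] /andP[_ /eqP e2].
    by move: (rne i j i4 j4 ne); rewrite -e1 -e2 eqxx.
  + by rewrite disjoint_sym.
  + by move: ne; rewrite (E i i4) (E j j4) eqxx.
- move=> i j ne; rewrite /F; case: ifPn => i4; case: ifPn => j4 //.
  + have [x [y [xU yU e1 e2 gxy]]] := i_touch I u0U (rB i i4) (rB j j4) (rne i j i4 j4 ne).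
    by exists x, y; rewrite !inE xU yU e1 e2 !eqxx.
  + exact: tC.
  + by have [x [y [? ? gxy]]] := tC j j4; exists y, x; rewrite g_sym.
  + by move: ne; rewrite (E i i4) (E j j4) eqxx.
Qed.

(** The region [C] is a fresh name: every earlier region contains an assigned vertex. The new owner
    is the youngest around [C], so the depths, and with them the radii, of the old owners do not
    change. *)
Lemma birth : ~ K5_minor -> B \subset abut -> exists U' D' tau' b',
  step_ok true U' D' tau' b' /\ #|C |: B| <= 4 /\ #|U'| < #|U|.
Proof.
move=> nK sB; have B3 := bag_small nK sB.
pose s := enum B; have szs : size s <= 3 by rewrite -cardE.
(* [u0] stands in for a missing terminal when the bag has fewer than three owners. *)
have term i : exists2 t, t \in C & i < size s ->
    exists y, [/\ y \notin U, g t y & D y = nth set0 s i].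
  case: (ltnP i (size s)) => h; last by exists u0.
  have : nth set0 s i \in B by rewrite -mem_enum mem_nth.
  by move=> /(subsetP sB)/abutP[x [y [xC yU gxy e]]]; exists x => // _; exists y.
have [t0 t0C h0] := term 0; have [t1 t1C h1] := term 1; have [t2 t2C h2] := term 2.
have cC : conn C by apply: reg_conn.
have [T [[sTC T0 T1 T2] [cT coreT]]] := core_exists g_sym g_spans cC t0C t1C t2C.
have Ttouch R : R \in B -> exists x y, [/\ x \in T, y \notin U, D y = R & g x y].
  move=> RB; have Rs : R \in s by rewrite mem_enum.
  have e := nth_index set0 Rs; have := Rs; rewrite -index_mem.
  case: (index R s) e => [|[|[|i]]] e lt; last first.
  - by have := leq_trans lt szs.
  - by have [y [yU gy Dy]] := h2 lt; exists t2, y; rewrite -e.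
  - by have [y [yU gy Dy]] := h1 lt; exists t1, y; rewrite -e.
  - by have [y [yU gy Dy]] := h0 lt; exists t0, y; rewrite -e.
have inTC x : x \in T -> x \in C := subsetP sTC x.
have TU x : x \in T -> x \in U by move=> /inTC/inCU.
pose U' := U :\: T.
pose D' v := if v \in T then C else D v.
pose tau' v := if v \in T then v else tau v.
pose b' v := if v \in C then C |: b v else b v.
have sU : U' \subset U by apply: subsetDl.
have nT v : v \notin U -> v \notin T by apply: contra; apply: TU.
have nU v : v \notin U -> v \notin U' by apply: contra; apply: (subsetP sU).
have U'P v : v \notin U' -> v \in T \/ v \notin U.
  by rewrite in_setD negb_and negbK => /orP.
have agD v : v \notin U -> D' v = D v by move=> /nT; rewrite /D' => /negPf ->.
have agt v : v \notin U -> tau' v = tau v by move=> /nT; rewrite /tau' => /negPf ->.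
have DT v : v \in T -> D' v = C by rewrite /D' => ->.
have tT v : v \in T -> tau' v = v by rewrite /tau' => ->.
have TU' v : v \in T -> v \notin U' by move=> vT; rewrite in_setD vT.
have DnC v : v \notin U -> D v != C.
  move=> vU; have [h _ _ _ _] := i_own I vU.
  by apply: contraNneq vU => e; apply: inCU; rewrite -e.
have far : U :\: C \subset U' by apply: setDS.
have CC u v : u \in U -> v \in U -> g u v -> (u \in C) = (v \in C).
  move=> uU vU guv; apply/idP/idP => h; first exact: C_closed guv.
  by apply: C_closed h uU _; rewrite g_sym.
have CD v : v \notin U -> [disjoint C & D v] || (C \subset D v).
  move=> vU; case: (boolP [disjoint C & D v]) => //= /pred0Pn[x /andP[xC xD]].
  by have := i_reg I vU (inCU xC) xD; rewrite (reg_eq xC).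
have inv' : stage U' D' tau' b'.
  split=> //.
  - move=> v /U'P[vT|vU].
      by rewrite DT // tT // (DT v vT) (tT v vT); split=> //; [exact: inTC | exact: TU'].
    have [k1 k2 k3 k4 k5] := i_own I vU; rewrite agD // agt // agD // agt //.
    split=> //; first exact: nU.
    apply: conn_sub k5; apply/subsetP => w; rewrite !inE => /andP[wU tw].
    by rewrite negb_and wU orbT agt.
  - move=> v /U'P[vT|vU]; first by rewrite tT //; apply: nd_refl.
    by rewrite agD // agt //; apply: i_rad I _ vU.
  - have cE R : R != C -> cores U' D' tau' R = cores U D tau R.
      move=> ne; apply/setP => w; rewrite !inE; case: (boolP (w \in T)) => wT /=.
        by rewrite (TU _ wT) DT // [C == R]eq_sym (negPf ne) andbF.
      by rewrite /D' /tau' (negPf wT).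
    have cC' : cores U' D' tau' C = T.
      apply/setP => w; rewrite !inE; case: (boolP (w \in T)) => wT /=.
        by rewrite DT // tT // !eqxx.
      rewrite /D' (negPf wT); apply/negbTE/negP => /and3P[wU _].
      by rewrite (negPf (DnC w wU)).
    move=> v /U'P[vT|vU]; first by rewrite DT // cC'.
    by rewrite agD // cE ?DnC //; apply: i_core I _ vU.
  - move=> u R uU' Rb; have uU := subsetP sU u uU'.
    have sr := reg_sub sU uU'.
    have aux : R \in b u -> reg U' u \subset R /\ exists2 v, v \notin U' & D' v = R.
      move=> Rbu; have [h [v vU e]] := i_bag I uU Rbu.
      split; first exact: subset_trans h.
      by exists v; rewrite ?agD // nU.
    move: Rb; rewrite /b'; case: ifP => uC; last exact: aux.
    case/setU1P=> [->|]; last exact: aux.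
    split; first by apply: subset_trans sr _; rewrite (reg_eq uC).
    by exists t0; [exact: TU' | exact: DT].
  - move=> u uU'; rewrite /b'; case: ifP => uC; last exact: i_card I _ (subsetP sU u uU').
    by rewrite bag_const // cardsU1; apply: leq_add (leq_b1 _) B3.
  - move=> u u' /(subsetP sU) uU /(subsetP sU) uU' guu.
    by rewrite /b' (CC u u') // (i_cst I uU uU' guu).
  - move=> u v uU' vU' guv; have uU := subsetP sU u uU'.
    case: (U'P v vU') => [vT|vU].
      have uC : u \in C by rewrite (CC u v) //; [exact: inTC | exact: TU].
      by rewrite DT // tT // /b' uC setU11; split=> //; apply: nd_refl.
    have [k1 k2] := i_bd I uU vU guv; rewrite agD // agt // /b'.
    case: ifP => uC //; split; first by rewrite setU1r.
    rewrite (_ : depth _ _ = depth (b u) (D v)) //; apply: eq_card => Y; rewrite !inE.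
    case: eqP => [->|//] /=; symmetry; have sCD : C \subset D v.
      by apply: C_sub_bag; rewrite -(bag_const uC).
    by rewrite properE sCD andbF andbF.
  - move=> u K R uU' cK sK uK nK' KR own' [x xK px].
    have uU := subsetP sU u uU'; rewrite /b'.
    have ownO y : y \in K -> y \notin U -> D y \subset R.
      by move=> yK yU; rewrite -agD //; apply: own' => //; apply: nU.
    have potB : x \in C -> R = C \/ R \in B.
      move=> xC; move: px; rewrite /pot /b' xC; case: ifP => xU'.
        by rewrite bag_const // => /setU1P.
      case: (U'P x (negbT xU')) => [xT|xU]; last by rewrite (inCU xC) in xU.
      by rewrite DT // => /eqP; left.
    have px' : R != C -> pot U D b x R.
      move=> ne; rewrite /pot; case: ifP => xU.
        case: (boolP (x \in C)) => xC.
          by rewrite bag_const //; case: (potB xC) => // e; rewrite e eqxx in ne.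
        have xU' : x \in U' by apply: (subsetP far); rewrite inE xC.
        by move: px; rewrite /pot /b' xU' (negPf xC).
      by move: px; rewrite /pot (negPf (nU _ (negbT xU))) agD // xU.
    case: ifP => uC; last first.
      have ne : R != C by apply: contraFneq uC => <-; apply: (subsetP KR).
      apply: (i_J I uU cK sK uK _ KR ownO); last by exists x => //; apply: px'.
      by rewrite -(reg_far sU far) // inE uC.
    case: (eqVneq R C) => [->|ne]; first exact: setU11.
    apply: setU1r; case: (boolP (K \subset C)) => KC.
      rewrite bag_const //; case: (potB (subsetP KC x xK)) => // e.
      by rewrite e eqxx in ne.
    have nKr : ~~ (K \subset reg U u) by rewrite (reg_eq uC).
    by apply: (i_J I uU cK sK uK nKr KR ownO); exists x => //; apply: px'.
  - move=> u R R' uU' Rb Rb' ne; have uU := subsetP sU u uU'.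
    have old : R \in b u -> R' \in b u ->
        exists x y, [/\ x \notin U', y \notin U', D' x = R, D' y = R' & g x y].
      move=> k1 k2; have [x [y [xU yU <- <- gxy]]] := i_touch I uU k1 k2 ne.
      by exists x, y; rewrite !agD // !nU.
    move: Rb Rb'; rewrite /b'; case: ifP => uC; last exact: old.
    case/setU1P=> [eR|k1]; case/setU1P=> [eR'|k2]; last exact: old.
    + by rewrite eR eR' eqxx in ne.
    + rewrite bag_const // in k2; have [x [y [xT yU Dy gxy]]] := Ttouch R' k2.
      by exists x, y; rewrite (DT x) // (agD y) // eR TU' // nU.
    + rewrite bag_const // in k1; have [x [y [xT yU Dy gxy]]] := Ttouch R k1.
      by exists y, x; rewrite (DT x) // (agD y) // eR' (TU' x) // (nU y) // g_sym.
  - move=> v v' /U'P[vT|vU] /U'P[vT'|vU'].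
    + by rewrite !DT // subxx !orbT.
    + by rewrite (DT v) // (agD v') //; case/orP: (CD v' vU') => ->; rewrite ?orbT.
    + by rewrite (DT v') // (agD v) // disjoint_sym; case/orP: (CD v vU) => ->; rewrite ?orbT.
    + by rewrite !agD //; apply: i_lam I _ _ vU vU'.
  - have aux v v' : v \in T -> v' \notin U -> g v v' -> C \subset D v'.
      move=> vT vU gvv; apply: C_sub_bag; rewrite -(bag_const (inTC _ vT)).
      by have [] := i_bd I (TU _ vT) vU gvv.
    move=> v v' /U'P[vT|vU] /U'P[vT'|vU'] gvv.
    + by rewrite !DT // subxx.
    + by rewrite (DT v) // (agD v') // (aux v v').
    + by rewrite (DT v') // (agD v) // (aux v' v) ?orbT // g_sym.
    + by rewrite !agD //; apply: i_edge I _ _ vU vU' gvv.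
  - move=> v u /U'P[vT|vU] uU' uD; have uU := subsetP sU u uU'.
      by rewrite DT // in uD *; apply: subset_trans (reg_sub sU uU') _; rewrite (reg_eq uD).
    rewrite agD // in uD *.
    exact: subset_trans (reg_sub sU uU') (i_reg I vU uU uD).
exists U', D', tau', b'; split; last split.
- split=> // [v /setDP[vU vU']|u uU'].
    by case: (U'P v vU') => [vT|]; [split; [exact: inTC | exact: DT] | rewrite vU].
  by rewrite /b'; case: ifP => // uC; rewrite bag_const.
- by rewrite cardsU1; apply: leq_add (leq_b1 _) B3.
- apply: proper_card; apply/properP; split=> //; exists t0; [exact: TU | exact: TU'].
Qed.

End Step.
End Process.

(** * Final owners and the graph of cells *)

Lemma dist_le_trans (T : finType) (e : rel T) m n x y z :
  dist_le e m x y -> dist_le e n y z -> dist_le e (m + n) x z.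
Proof.
case=> p [pp <- sp] [q [pq <- sq]]; exists (p ++ q).
by rewrite cat_path last_cat size_cat pp pq; split=> //; apply: leq_add.
Qed.

Lemma dist_le_leq (T : finType) (e : rel T) m n x y :
  m <= n -> dist_le e m x y -> dist_le e n x y.
Proof. by move=> mn [p [? ? s]]; exists p; split=> //; apply: leq_trans mn. Qed.

Lemma dist_le_refl (T : finType) (e : rel T) n x : dist_le e n x x.
Proof. by exists [::]. Qed.

Lemma dist_le1 (T : finType) (e : rel T) x y : (x != y -> e x y) -> dist_le e 1 x y.
Proof.
case: (eqVneq x y) => [-> _|_ /(_ isT) exy]; first exact: dist_le_refl.
by exists [:: y]; rewrite /= exy.
Qed.

Lemma dist_le_sym (T : finType) (e : rel T) n x y : symmetric e ->
  dist_le e n x y -> dist_le e n y x.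
Proof.
move=> es [p [pp <- sp]]; exists (rev (belast x p)); split.
- by rewrite rev_path; apply: sub_path pp => u v; rewrite es.
- by case: p {pp sp} => [|z p] //=; rewrite rev_cons last_rcons.
- by rewrite size_rev size_belast.
Qed.

Section Completion.
Variables (V : finType) (g : rel V) (H : {set {set V}}).
Hypothesis g_sym : symmetric g.
Hypothesis g_spans : spans g H.
Implicit Types (A B C K U X Y R T N : {set V}) (x y z u v w : V) (m n p q : nat).
Implicit Types (D : V -> {set V}) (tau : V -> V) (b : V -> {set {set V}}).
Implicit Types (S : {set {set V}}) (beta : V -> {set {set V}}).
Local Notation nd := (nd g H).
Local Notation lnk := (lnk g H).
Local Notation conn := (conn g).
Local Notation small := (small H).
Local Notation reg := (reg g).
Local Notation stage := (stage g H).

(** The set [beta a] depends on [a] alone, not on [K]. This lets the final recursion replace [K] by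
    smaller and smaller parts while counting in the same four-element supply. *)
Definition oldest_in D beta a : Prop := #|beta a| <= 4 /\
  forall K R, conn K -> small K -> a \in K -> (forall x, x \in K -> D x \subset R) ->
    (exists2 x, x \in K & D x = R) -> R \in beta a.

Definition completes U D b D' tau' b' beta : Prop :=
  [/\ stage set0 D' tau' b', forall v, v \notin U -> D' v = D v,
      forall x, x \in U -> D' x \in b x \/ D' x \subset reg U x &
      forall a, a \in U -> oldest_in D' beta a].

(** A vertex handed over in this step gets the bag of [C] as [beta], enlarged by [C] at a birth. If
    [K] leaves [C], then [i_J] puts [R] into the bag. If [K] stays in [C], then [R] is in the bag or
    inside [C]; since it contains the owner region of [a], hence [C], the latter means [R = C],
    which only a birth allows. *)
Lemma step_completes U D tau b u0 birth U1 D1 tau1 b1 D' tau' b' beta :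
  stage U D tau b -> u0 \in U ->
  step_ok g H U D b u0 birth U1 D1 tau1 b1 ->
  (birth -> #|reg U u0 |: b u0| <= 4) ->
  completes U1 D1 b1 D' tau' b' beta ->
  exists beta', completes U D b D' tau' b' beta'.
Proof.
move=> I u0U [I1 sU agD1 new1 b1s] card4 [I' agD dom bet].
set C := reg U u0 in new1 b1s card4.
have nU v : v \notin U -> v \notin U1 by apply: contra; apply: (subsetP sU).
have CU x : x \in C -> x \in U by apply: (subsetP (reg_subU _ _ _)).
have bC x : x \in C -> b x = b u0 by move=> xC; apply: (bag_const I u0U).
have dom' x : x \in U -> D' x \in b x \/ D' x \subset reg U x.
  move=> xU; case: (boolP (x \in U1)) => xU1; last first.
    have [|xC] := new1 x; first by rewrite inE xU1.
    rewrite agD //; case: (birth) => h.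
      by right; rewrite h (reg_eq g_sym xC).
    by left; rewrite bC.
  have := b1s x xU1; case: (dom x xU1) => [h1|h1] h2; last first.
    by right; apply: subset_trans h1 _; apply: reg_sub.
  have := subsetP h2 _ h1; case: ifP => xC; last by left.
  case: (birth); rewrite -(bC x xC); last by left.
  case/setU1P=> [->|]; [right; by rewrite (reg_eq g_sym xC) | by left].
exists (fun a => if a \in U1 then beta a else if birth then C |: b u0 else b u0).
split=> //; first by move=> v vU; rewrite agD ?nU // agD1.
move=> a aU; case: (boolP (a \in U1)) => aU1.
  by have [h1 h2] := bet a aU1; split; rewrite aU1.
have [|aC] := new1 a; first by rewrite inE aU1.
rewrite -(agD a aU1) => Da; split.
  rewrite (negPf aU1); case: (birth) card4 => [h|_]; first exact: h.
  exact: i_card I _ u0U.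
move=> K R cK sK aK owns [x xK Dx]; rewrite (negPf aU1).
have inD v : v \in D' v by have [] := i_own I' (v := v) (ltac:(by rewrite inE)).
have KR : K \subset R by apply/subsetP => y yK; apply: (subsetP (owns y yK)); apply: inD.
case: (boolP (K \subset C)) => KC; last first.
  have : R \in b a; last by rewrite bC //; case: (birth) => // h; rewrite setU1r.
  apply: (i_J I aU cK sK aK _ KR).
  - by rewrite (reg_eq g_sym aC).
  - by move=> y yK yU; have := owns y yK; rewrite agD ?nU // agD1.
  exists x => //; rewrite /pot; case: ifPn => xU; last first.
    by rewrite -agD1 // -agD ?nU // Dx.
  case: (dom' x xU); rewrite Dx // => Rr; case/negP: KC.
  have ax : a \in reg U x by apply: (subsetP Rr); apply: (subsetP KR).
  by apply: subset_trans KR _; rewrite /C -(reg_eq g_sym aC) (reg_eq g_sym ax).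
have xC := subsetP KC x xK; have aR := owns a aK.
have CR : C \subset R.
  case: (birth) Da => [<- //|h]; apply: subset_trans aR.
  by apply: (C_sub_bag I u0U).
have := dom' x (CU x xC); rewrite Dx bC // (reg_eq g_sym xC) => -[h|h].
  by case: (birth) => //; rewrite setU1r.
have eR : R = C by apply/eqP; rewrite eqEsubset CR andbT.
case: (birth) Da => [_|hB]; first by rewrite eR setU11.
have := bag_notin I u0U hB; case/negP; apply: subset_trans aR _.
by rewrite eR; apply: reg_subU.
Qed.

Lemma complete (nK : ~ K5_minor g) n : forall m U D tau b, stage U D tau b ->
  #|U| <= n -> \sum_(u in U) #|b u| <= m ->
  exists D' tau' b' beta, completes U D b D' tau' b' beta.
Proof.
elim: n => [|n IHn].
  move=> m U D tau b I; rewrite leqn0 cards_eq0 => /eqP eU _; rewrite eU in I *.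
  by exists D, tau, b, b; split=> // x; rewrite inE.
elim=> [|m IHm] U D tau b I cU sb.
all: have [eU|/set0Pn[u uU]] := eqVneq U set0;
  first by rewrite eU in I *; exists D, tau, b, b; split=> // x; rewrite inE.
all: have [/existsP[u0 /andP[u0U nad]]|nad] :=
  boolP [exists u0, (u0 \in U) && ~~ (b u0 \subset abut g U D u0)].
1,3: have [U1 [D1 [tau1 [b1 [ok1 dec]]]]] := shave g_sym g_spans I u0U nad;
  case: dec => [lt|[eU dec]];
  first by have [I1 _ _ _ _] := ok1;
    have [D' [tau' [b' [beta cp]]]] := IHn _ U1 D1 tau1 b1 I1 (leq_trans lt cU) (leqnn _);
    have [//|beta' ?] := step_completes I u0U ok1 _ cp; exists D', tau', b', beta'.
- by move: (leq_trans dec sb).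
- have [I1 _ _ _ _] := ok1; rewrite eU in I1 ok1.
  have [D' [tau' [b' [beta cp]]]] := IHm U D1 tau1 b1 I1 cU (leq_trans dec sb).
  by have [//|beta' ?] := step_completes I u0U ok1 _ cp; exists D', tau', b', beta'.
all: have sad : b u \subset abut g U D u;
  first by apply: contraT => h; case/negP: nad; apply/existsP; exists u; rewrite uU.
all: have [U1 [D1 [tau1 [b1 [ok1 [c4 lt]]]]]] := birth g_sym g_spans I uU nK sad;
  have [I1 _ _ _ _] := ok1;
  have [D' [tau' [b' [beta cp]]]] := IHn _ U1 D1 tau1 b1 I1 (leq_trans lt cU) (leqnn _);
  have [//|beta' ?] := step_completes I uU ok1 _ cp; by exists D', tau', b', beta'.
Qed.

Lemma owners_exist : ~ K5_minor g -> exists D tau b beta,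
  stage set0 D tau b /\ forall a, oldest_in D beta a.
Proof.
move=> nK; have I0 : stage [set: V] (fun _ => set0) id (fun _ => set0).
  split=> // [v|v|v|u R _|u _|u v _|u K R uU _ _ uK _ _ _ [x _]|u R R' _|v v'|v v'|v u];
    rewrite ?inE ?cards0 //.
  by rewrite /pot inE inE.
have [D [tau [b [beta [I _ _ h]]]]] := complete nK I0 (leqnn _) (leqnn _).
by exists D, tau, b, beta; split=> // a; apply: h; rewrite inE.
Qed.

Lemma nd_RIG n a a' A A' : nd setT n a a' -> a \in A -> A \in H -> a' \in A' -> A' \in H ->
  dist_le (RIG H) n.+1 A A'.
Proof.
have one X Y z : X \in H -> Y \in H -> z \in X -> z \in Y -> dist_le (RIG H) 1 X Y.
  move=> XH YH zX zY; apply: dist_le1 => ne; rewrite /RIG /= XH YH ne /=.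
  by apply/negP => dis; have := disjointFr dis zX; rewrite zY.
elim: n a A => [|n IH] a A /= => [/eqP->|/existsP[z /andP[l d]]] aA AH a'A A'H.
  exact: one aA a'A.
case/orP: l => [/eqP e|/exists_inP[X XH /and3P[/setIP[aX _] /setIP[zX _] _]]].
  by rewrite -e in d; apply: dist_le_leq (IH _ _ d aA AH a'A A'H).
exact: dist_le_trans (one _ _ _ AH XH aA aX) (IH _ _ d zX XH a'A A'H).
Qed.

(** From each of the two vertices: the recursive bound and one edge to reach the oldest owner; then
    one step between two cells of that owner. Four rounds give 45. *)
Fixpoint hops k := if k is k'.+1 then 2 * hops k' + 3 else 0.

Theorem K5_free_impression : {in H, forall A, connected_set g A} -> ~ K5_minor g ->
  exists M, impression g H M 73936 80.
Proof.
move=> Hc nK; have [D [tau [b [beta [I bet]]]]] := owners_exist nK.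
have n0 v : v \notin (set0 : {set V}) by rewrite inE.
(* The block length exceeds [8400 + 1 + 8400], the bound on the distance of the anchors of two
   linked vertices with the same owner. *)
have L0 : 0 < 16802 by [].
pose coreR R := cores set0 D tau R.
have [blk hblk] : exists blk : {set V} -> V -> nat, forall v,
   [/\ {in coreR (D v) &, forall w w', blk (D v) w = blk (D v) w' -> nd (D v) (2 * 16802) w w'},
      {in coreR (D v) &, forall w w', forall n, nd (D v) n w w' -> n < 16802 ->
         blk (D v) w = blk (D v) w' \/ exists x y,
           [/\ x \in coreR (D v), y \in coreR (D v), blk (D v) x = blk (D v) w,
               blk (D v) y = blk (D v) w' & g x y]} &
      {in coreR (D v) &, forall w w', blk (D v) w = blk (D v) w' ->
         connect (induced g [set x in coreR (D v) | blk (D v) x == blk (D v) w]) w w'}].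
  have h R : exists f : V -> nat, [exists v, D v == R] ->
   [/\ {in coreR R &, forall w w', f w = f w' -> nd R (2 * 16802) w w'},
      {in coreR R &, forall w w', forall n, nd R n w w' -> n < 16802 ->
         f w = f w' \/ exists x y,
           [/\ x \in coreR R, y \in coreR R, f x = f w, f y = f w' & g x y]} &
      {in coreR R &, forall w w', f w = f w' ->
         connect (induced g [set x in coreR R | f x == f w]) w w'}].
    case: (boolP [exists v, D v == R]) => [/existsP[v /eqP <-]|_]; last by exists (fun _ => 0).
    by have [f [col [_ h2 h3 h4]]] := (i_core I (n0 v)).1 _ L0; exists f.
  have [F hF] := fin_all_exists h; exists F => v; apply: hF.
  by apply/existsP; exists v.
pose cell v := [set u | (D u == D v) && (blk (D v) (tau u) == blk (D v) (tau v))].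
pose M := [set cell v | v : V].
have cself v : v \in cell v by rewrite inE !eqxx.
have ceq u v : u \in cell v -> cell u = cell v.
  by rewrite inE => /andP[/eqP e1 /eqP e2]; apply/setP => w; rewrite !inE e1 e2.
have cM v : cell v \in M by apply/imsetP; exists v.
have own v := i_own I (n0 v).
have tcore v : tau v \in coreR (D v).
  by have [_ h2 h3 h4 _] := own v; rewrite inE h2 h3 h4 !eqxx.
have cconn v : conn (cell v).
  have tofib u : u \in cell v -> connect (induced g (cell v)) u (tau u).
    rewrite inE => /andP[/eqP e1 /eqP e2]; have [_ _ h3 _ h5] := own u.
    apply: conn_sub h5; apply/subsetP => w; rewrite !inE => /eqP tw.
    by have [_ _ k3 _ _] := own w; rewrite -k3 tw h3 e1 eqxx e2 eqxx.
  have mid u u' : u \in cell v -> u' \in cell v -> connect (induced g (cell v)) (tau u) (tau u').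
    rewrite !inE => /andP[/eqP e1 /eqP e2] /andP[/eqP e3 /eqP e4].
    have [_ _ h4] := hblk v; have t1 := tcore u; have t2 := tcore u'.
    rewrite e1 in t1; rewrite e3 in t2.
    apply: conn_sub (h4 _ _ t1 t2 (etrans e2 (esym e4))); apply/subsetP => w.
    rewrite !inE => /andP[/and3P[_ /eqP tw /eqP Dw] /eqP bw].
    by rewrite Dw tw bw e2 !eqxx.
  move=> u u' uv uv'; apply: connect_trans (tofib _ uv) _.
  by apply: connect_trans (mid _ _ uv uv') _; rewrite conn_sym //; apply: tofib.
have lkR v v' n : D v' = D v -> nd (D v) n v v' -> n + 16800 < 16802 ->
    nd (D v) (8400 + n + 8400) (tau v) (tau v').
  move=> e d _; have r1 := i_rad I (n0 v); have r2 := i_rad I (n0 v'); rewrite e in r2.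
  exact: nd_trans (nd_trans (nd_symm g_sym r1) d) r2.
have IMs : symmetric (IM g M).
  move=> X Y; rewrite /IM /= eq_sym; case: (X \in M); case: (Y \in M); rewrite //= ?andbF //.
  congr (_ && _); apply/exists_inP/exists_inP => -[x xX /exists_inP[y yY gxy]];
    by exists y => //; apply/exists_inP; exists x => //; rewrite g_sym.
have IMe u v : g u v -> dist_le (IM g M) 1 (cell u) (cell v).
  move=> guv; apply: dist_le1 => ne; rewrite /IM /= !cM ne /=.
  by apply/exists_inP; exists u => //; apply/exists_inP; exists v.
(* Take a region of largest size. An edge leaving the vertices whose regions it contains would lead
   to a region that meets it, and laminarity would make that region contain it, hence equal it. *)
have top K u : conn K -> u \in K -> exists2 x0, x0 \in K & forall x, x \in K -> D x \subset D x0.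
  move=> cK uK.
  have [x0 x0K hmax] : exists2 x, x \in K & forall y, y \in K -> #|D y| <= #|D x|.
    by case: (arg_maxnP (fun x => #|D x|) uK) => x xK h; exists x.
  exists x0 => // x xK; apply: contraT => nx.
  have [||p [q [[pK qK Dp Dq] [gpq _]]]] :=
    @conn_exit _ g _ (fun x => D x \subset D x0) _ _ (cK x0 x x0K xK) => //.
  case/orP: (i_edge I (n0 p) (n0 q) gpq) => s; last first.
    by case/negP: Dq; apply: subset_trans s Dp.
  case/or3P: (i_lam I (n0 x0) (n0 q)) => s'; last by case/negP: Dq.
    have [pD _ _ _ _] := own p; have := disjointFr s' (subsetP Dp p pD).
    by rewrite (subsetP s p pD).
  case/negP: Dq; suff -> : D x0 = D q by [].
  by apply/eqP; rewrite eqEcard s'; apply: hmax.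
(* [S] collects the owners removed so far. The oldest owner of the current [K] lies in [beta v] for
   all [v] in [K] and outside [S], so with four removed owners it would be a fifth element.
   Otherwise it joins [S], and the recursion runs on the components of [K] without its vertices. *)
have key k : forall K S, conn K -> small K -> #|S| + k = 4 ->
    (forall v, v \in K -> S \subset beta v /\ D v \notin S) ->
    {in K &, forall u v, dist_le (IM g M) (hops k) (cell u) (cell v)}.
  elim: k => [|k IH] K S cK sK cS hS u v uK vK; have [x0 x0K owns] := top K u cK uK;
  have oldK x : x \in K -> D x0 \in beta x
    by move=> xK; apply: ((bet x).2 K) => //; exists x0.
    have [sb nx] := hS x0 x0K; case/negP: nx.
    suff -> : S = beta x0 by apply: oldK.
    by apply/eqP; rewrite eqEcard sb -(addn0 #|S|) cS (bet x0).1.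
  have toR w : w \in K -> exists y, [/\ y \in K, D y = D x0 &
      dist_le (IM g M) (hops k).+1 (cell w) (cell y)].
    move=> wK; have [e|ne] := eqVneq (D w) (D x0).
      by exists w; split=> //; apply: dist_le_refl.
    pose K1 := [set x in K | D x != D x0]; have wK1 : w \in K1 by rewrite inE wK.
    have sr : reg K1 w \subset K.
      by apply: subset_trans (reg_subU _ _ _) _; apply/subsetP => x; rewrite inE => /andP[].
    have [||p [q [[pK qK pr qr] [gpq _]]]] :=
      @conn_exit _ g _ (fun x => x \in reg K1 w) _ _ (cK w x0 wK x0K).
    - exact: reg_self.
    - by apply/negP => /(subsetP (reg_subU _ _ _)); rewrite inE eqxx andbF.
    have Dq : D q = D x0.
      apply/eqP; apply: contraT => nq; case/negP: qr.
      by apply: (reg_closed pr _ gpq); rewrite inE qK.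
    exists q; split=> //; rewrite -addn1; apply: dist_le_trans (IMe _ _ gpq).
    apply: (IH (reg K1 w) (D x0 |: S)) => //.
    - exact: reg_conn.
    - case/exists_inP: sK => A AH KA; apply/exists_inP; exists A => //.
      exact: subset_trans sr KA.
    - by have [_ nx] := hS x0 x0K; rewrite cardsU1 nx /= add1n addSnnS.
    - move=> x xr; have xK := subsetP sr x xr; have [sb nx] := hS x xK.
      split; first by rewrite subUset sub1set oldK.
      rewrite in_setU1 negb_or nx andbT.
      have := subsetP (reg_subU _ _ _) x xr; by rewrite inE => /andP[].
    - exact: reg_self.
  (* Every vertex lies in its own region, so all of [K] lies in the region of its oldest owner.
     There [y] and [y'] are one link apart, and their anchors fall into equal or adjacent blocks. *)
  have mid y y' : y \in K -> y' \in K -> D y = D x0 -> D y' = D x0 ->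
      dist_le (IM g M) 1 (cell y) (cell y').
    move=> yK y'K e e'; have KR : K \subset D y.
      apply/subsetP => x xK; rewrite e; apply: (subsetP (owns x xK)).
      by have [] := own x.
    have l1 : lnk (D y) y y'.
      case/exists_inP: sK => A AH KA; exact: (lnk_piece AH KA KR yK (cK _ _ yK y'K)).
    have d := lkR y y' 1 (etrans e' (esym e)) (nd_lnk l1) isT.
    have [_ h3 _] := hblk y; have t2 := tcore y'; rewrite e' -e in t2.
    case: (h3 _ _ (tcore y) t2 _ d isT) => [eb|[x1 [y1 [x1c y1c b1 b2 g1]]]].
      have -> : cell y = cell y'; last exact: dist_le_refl.
      by apply: ceq; rewrite inE e e' eqxx -e eb eqxx.
    move: x1c y1c; rewrite !inE => /and3P[_ /eqP t1 /eqP D1] /and3P[_ /eqP t3 /eqP D3].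
    have -> : cell y = cell x1.
      by apply/esym/ceq; rewrite inE D1 t1 b1 !eqxx.
    have -> : cell y' = cell y1.
      by apply/esym/ceq; rewrite inE D3 t3 e' -e b2 !eqxx.
    exact: IMe.
  have [y [yK e d]] := toR u uK; have [y' [yK' e' d']] := toR v vK.
  have := dist_le_trans (dist_le_trans d (mid _ _ yK yK' e e')) (dist_le_sym IMs d').
  by apply: dist_le_leq => /=; clear; lia.
exists M; split.
- move=> X /imsetP[v _ ->]; split; last exact: cconn.
  by apply/set0Pn; exists v.
- apply/trivIsetP => X Y /imsetP[u _ ->] /imsetP[v _ ->] ne.
  rewrite -setI_eq0; apply/eqP/setP => w; rewrite in_setI in_set0; apply/negP => /andP[h1 h2].
  by case/eqP: ne; rewrite -(ceq _ _ h1) -(ceq _ _ h2).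
- apply/setP => v; rewrite [RHS]inE; apply/bigcupP; exists (cell v) => //.
- move=> X /imsetP[v _ ->] A A'; rewrite !in_set => /andP[AH +] /andP[AH' +].
  rewrite -!setI_eq0 => /set0Pn[a /setIP[aA ac]] /set0Pn[a' /setIP[aA' ac']].
  move: (ac) (ac'); rewrite !in_set => /andP[/eqP e1 /eqP e2] /andP[/eqP e3 /eqP e4].
  have t1 := tcore a; have t2 := tcore a'; rewrite e1 in t1; rewrite e3 in t2.
  have [h2 _ _] := hblk v; have d := h2 _ _ t1 t2 (etrans e2 (esym e4)).
  have r1 := i_rad I (n0 a); have r2 := i_rad I (n0 a'); rewrite e1 in r1; rewrite e3 in r2.
  (* Two radii and a block diameter: [8400 + 2 * 16802 + 8400 = 50404] links, hence 50405 steps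
     between members of [H]. *)
  have dd := nd_trans (nd_trans r1 d) (nd_symm g_sym r2).
  by apply: dist_le_leq (nd_RIG (nd_sub (subsetT _) dd) aA AH aA' AH').
- move=> A AH X Y; rewrite !in_set => /andP[/imsetP[v _ ->] +] /andP[/imsetP[v' _ ->] +].
  rewrite -!setI_eq0 => /set0Pn[a /setIP[ac aA]] /set0Pn[a' /setIP[ac' aA']].
  rewrite -(ceq _ _ ac) -(ceq _ _ ac').
  have : dist_le (IM g M) (hops 4) (cell a) (cell a').
    apply: (key 4 A set0) => //; first by have [] := Hc A AH.
    - by apply/exists_inP; exists A.
    - by rewrite cards0.
    - by move=> w _; rewrite sub0set inE.
  by apply: dist_le_leq.
Qed.

End Completion.

(** * Planarity *)

Lemma xorb_addb b c : xorb b c = b (+) c. Proof. by case: b; case: c. Qed.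

Ltac cross_cases := rewrite !xorb_addb; lia.

(** * Crossing parities of lattice walks *)

Section Lattice.
Local Open Scope ring_scope.
Local Notation pt := (int * int)%type.
Implicit Types (a c i j k l x y s t : pt) (p q : seq pt).

Fixpoint crossings (P : pt -> pt -> bool) x p : bool :=
  if p is y :: p' then xorb (P x y) (crossings P y p') else false.

Definition ustep s t : bool :=
  ((s.1 == t.1) && ((s.2 == t.2 + 1) || (t.2 == s.2 + 1))) ||
  ((s.2 == t.2) && ((s.1 == t.1 + 1) || (t.1 == s.1 + 1))).

Lemma ustep_sym : symmetric ustep.
Proof. by move=> s t; rewrite /ustep; lia. Qed.

Lemma crossings_cat P x p q :
  crossings P x (p ++ q) = xorb (crossings P x p) (crossings P (last x p) q).
Proof.
elim: p x => [|y p IH] x /=; first by case: crossings.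
by rewrite IH; btauto.
Qed.

Lemma crossings_xor P Q x p :
  crossings (fun s t => xorb (P s t) (Q s t)) x p =
  xorb (crossings P x p) (crossings Q x p).
Proof. by elim: p x => [|y p IH] x //=; rewrite IH; btauto. Qed.

Lemma eq_crossings P Q x p : path ustep x p ->
  (forall s t, s \in x :: p -> t \in x :: p -> ustep s t -> P s t = Q s t) ->
  crossings P x p = crossings Q x p.
Proof.
elim: p x => [|y p IH] x //= /andP[xy pp] h.
rewrite (h x y) ?inE ?eqxx ?orbT // (IH y) // => s t sp tp.
by apply: h; rewrite inE ?sp ?tp orbT.
Qed.

Lemma crossings_telescope (F : pt -> bool) x p :
  crossings (fun s t => xorb (F s) (F t)) x p = xorb (F x) (F (last x p)).
Proof. by elim: p x => [|y p IH] x /=; [|rewrite IH]; btauto. Qed.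

(* Horizontal steps across the vertical ray going up from k, displaced by
   half a unit to the left. *)
Definition ray_step k s t : bool :=
  [&& s.2 == t.2, k.2 <= s.2 &
      ((s.1 == k.1 - 1) && (t.1 == k.1)) || ((t.1 == k.1 - 1) && (s.1 == k.1))].

Definition ray k x p := crossings (ray_step k) x p.

Definition above a s : bool := (s.1 == a.1) && (a.2 <= s.2).

(** This has two readings, and [ray_swap] lives on both: the step crosses the ray going down from
    [i], displaced half a unit to the right; or [i] lies on or above the left end of the step. *)
Definition low_step i s t : bool :=
  [&& s.2 == t.2, s.2 <= i.2 & Num.min s.1 t.1 == i.1].

Lemma neq_pt a s : a != s -> (a.1 != s.1) || (a.2 != s.2).
Proof. by case: a => a1 a2; case: s => s1 s2; rewrite xpair_eqE negb_and. Qed.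

Lemma ray_up a x p : path ustep x p -> a \notin x :: p ->
  ray a x p = ray (a.1, a.2 + 1) x p.
Proof.
move=> px ax; apply: eq_crossings px _ => s t sp tp _.
have := neq_pt (memPn ax s sp); have := neq_pt (memPn ax t tp).
by rewrite /ray_step /=; lia.
Qed.

(** The two displaced rays bound the half-column above [a]. A walk avoiding its lowest point [a]
    enters or leaves it only sideways, so the parity tells which ends of the walk lie inside. *)
Lemma ray_right a x p : path ustep x p -> a \notin x :: p ->
  xorb (ray a x p) (ray (a.1 + 1, a.2) x p) = xorb (above a x) (above a (last x p)).
Proof.
move=> px ax; rewrite -crossings_telescope -crossings_xor.
apply: eq_crossings px _ => s t sp tp.
move: (neq_pt (memPn ax s sp)) (neq_pt (memPn ax t tp)); clear.
rewrite /ray_step /above /ustep; case: a s t => a1 a2 [s1 s2] [t1 t2] /=.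
by move=> n1 n2 /orP[]/andP[/eqP e /orP[]/eqP d]; move: n1 n2; rewrite e d ?eqxx /=; cross_cases.
Qed.

Lemma ray_step_change s t x p : path ustep x p -> ustep s t ->
  s \notin x :: p -> t \notin x :: p ->
  xorb (ray s x p) (ray t x p) = xorb (low_step x s t) (low_step (last x p) s t).
Proof.
move=> px + sp tp; case/orP=> /andP[/eqP e /orP[]/eqP d].
- have -> : s = (t.1, t.2 + 1) by rewrite -e -d; case: (s).
  rewrite -ray_up // /low_step /=.
  by rewrite (_ : (t.2 + 1 == t.2) = false); [case: ray | lia].
- have -> : t = (s.1, s.2 + 1) by rewrite e -d; case: (t).
  rewrite -ray_up // /low_step /=.
  by rewrite (_ : (s.2 == s.2 + 1) = false); [case: ray | lia].
- have -> : s = (t.1 + 1, t.2) by rewrite -e -d; case: (s).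
  have xC (b1 b2 : bool) : xorb b1 b2 = xorb b2 b1 by case: b1; case: b2.
  rewrite xC ray_right // /low_step /above /=.
  by congr xorb; rewrite eqxx /=; lia.
- have -> : t = (s.1 + 1, s.2) by rewrite e -d; case: (t).
  rewrite ray_right // /low_step /above /=.
  by congr xorb; rewrite eqxx /=; lia.
Qed.

Lemma ray_along k q x p : path ustep x p -> path ustep k q ->
  (forall s, s \in k :: q -> s \notin x :: p) ->
  xorb (ray k x p) (ray (last k q) x p) =
  xorb (crossings (low_step x) k q) (crossings (low_step (last x p)) k q).
Proof.
move=> px; elim: q k => [|t q IH] k /=; first by move=> _ _; case: ray.
case/andP=> kt pq h.
have hq s : s \in t :: q -> s \notin x :: p by move=> sq; apply: h; rewrite inE sq orbT.
have h1 := ray_step_change px kt (h k (mem_head _ _)) (hq t (mem_head _ _)).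
have h2 := IH t pq hq.
have : xorb (xorb (ray k x p) (ray t x p)) (xorb (ray t x p) (ray (last t q) x p)) =
  xorb (xorb (low_step x k t) (low_step (last x p) k t))
       (xorb (crossings (low_step x) t q) (crossings (low_step (last x p)) t q)) by rewrite h1 h2.
by move=> h3; apply: etrans (etrans h3 _); btauto.
Qed.

(** With no end in the column of [i], the upward ray may be moved to the right side. It then forms a
    full vertical line with the downward one, and crossings of a line are decided by the sides of
    the ends. *)
Lemma low_ray i k q : path ustep k q -> i \notin k :: q ->
  k.1 != i.1 -> (last k q).1 != i.1 ->
  xorb (crossings (low_step i) k q) (ray i k q) =
  xorb (k.1 <= i.1) ((last k q).1 <= i.1).
Proof.
move=> pq iq nk nl; have := ray_right pq iq.
rewrite /above (negPf nk) (negPf nl) /= => h.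
have -> : ray i k q = ray (i.1 + 1, i.2) k q by move: h; do 2 case: ray.
rewrite -crossings_xor -(crossings_telescope (fun s => s.1 <= i.1)).
apply: eq_crossings pq _ => s t sp tp.
move: (neq_pt (memPn iq s sp)) (neq_pt (memPn iq t tp)); clear.
rewrite /ray_step /low_step /ustep; case: i s t => a1 a2 [s1 s2] [t1 t2] /=.
by move=> n1 n2 /orP[]/andP[/eqP e /orP[]/eqP d]; move: n1 n2; rewrite e d ?eqxx /=; cross_cases.
Qed.

(** Sliding the ray from one end of [q] to the other counts the steps of [q] below the ends of [p],
    and [low_ray] turns these counts into rays based at the ends of [p]. The right side is odd
    exactly when the two pairs of first coordinates interleave. *)
Lemma ray_swap k q x p : path ustep x p -> path ustep k q ->
  (forall s, s \in k :: q -> s \notin x :: p) ->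
  k.1 != x.1 -> k.1 != (last x p).1 -> (last k q).1 != x.1 ->
  (last k q).1 != (last x p).1 ->
  xorb (xorb (ray k x p) (ray (last k q) x p)) (xorb (ray x k q) (ray (last x p) k q)) =
  xorb (xorb (k.1 <= x.1) ((last k q).1 <= x.1))
       (xorb (k.1 <= (last x p).1) ((last k q).1 <= (last x p).1)).
Proof.
move=> px pq dis n1 n2 n3 n4; rewrite (ray_along px pq dis).
have xq : x \notin k :: q by apply/negP => /dis; rewrite inE eqxx.
have lq : last x p \notin k :: q by apply/negP => /dis; rewrite mem_last.
by rewrite -(low_ray pq xq) // -(low_ray pq lq) //; btauto.
Qed.

Lemma ray_closed k q x p : path ustep x p -> path ustep k q -> last x p = x ->
  (forall s, s \in k :: q -> s \notin x :: p) -> ray k x p = ray (last k q) x p.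
Proof.
move=> px pq cl dis; have := ray_along px pq dis; rewrite cl.
by case: (crossings _ _ _); do 2 case: ray.
Qed.

Lemma ray_rev k x p : ray k (last x p) (rev (belast x p)) = ray k x p.
Proof.
elim: p x => [|y p IH] x //=; rewrite rev_cons -cats1 /ray crossings_cat.
have -> : last (last y p) (rev (belast y p)) = y.
  by case: p {IH} => [|z p] //=; rewrite rev_cons last_rcons.
rewrite -/(ray k _ _) IH /=.
have -> : ray_step k y x = ray_step k x y by rewrite /ray_step; lia.
by rewrite /ray; case: ray_step; case: crossings.
Qed.

Lemma rev_ustep x p : path ustep x p -> path ustep (last x p) (rev (belast x p)).
Proof. by rewrite rev_path; apply: sub_path => s t; rewrite ustep_sym. Qed.

Lemma last_rev_belast x p : last (last x p) (rev (belast x p)) = x.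
Proof. by case: p => [|z p] //=; rewrite rev_cons last_rcons. Qed.

Lemma xorb_accum (u v w : bool) : u = v -> w = false -> xorb (xorb u v) w = false.
Proof. by move=> -> ->; case: v. Qed.

(* The parity version of the nonplanarity of K_5: summed over all pairs of
   disjoint edges, the rays count every crossing twice, while four points on
   a line have exactly one interleaved pair of pairs. *)
Lemma lattice_K5 (P : nat -> pt) (q : nat -> nat -> seq pt) :
  (forall i j : nat, (i < j < 5)%N -> path ustep (P i) (q i j) /\ last (P i) (q i j) = P j) ->
  (forall i j k l : nat, (i < j < 5)%N -> (k < l < 5)%N -> uniq [:: i; j; k; l] ->
     forall s, s \in P i :: q i j -> s \notin P k :: q k l) ->
  (forall i j : nat, (i < j < 5)%N -> (P i).1 != (P j).1) -> False.
Proof.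
move=> hq dis hx; pose r (k i j : nat) := ray (P k) (P i) (q i j).
pose le (i j : nat) := (P i).1 <= (P j).1.
(* First coordinates are distinct, so [le i j] and [le j i] are complementary; [o] makes this
   visible to a propositional decision procedure. *)
pose o (i j : nat) := if (i < j)%N then le i j else ~~ le j i.
have hx' (i j : nat) : (i < 5)%N -> (j < 5)%N -> i != j -> (P i).1 != (P j).1.
  move=> i5 j5; rewrite neq_ltn => /orP[] h; first by apply: hx; rewrite h.
  by rewrite eq_sym; apply: hx; rewrite h.
have leo (i j : nat) : (i < 5)%N -> (j < 5)%N -> i != j -> le i j = o i j.
  move=> i5 j5 ne; rewrite /o; case: ltnP => // _; rewrite /le.
  by rewrite -ltNge lt_neqAle hx'.
have S (k l i j : nat) : (k < l < 5)%N -> (i < j < 5)%N -> uniq [:: k; l; i; j] ->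
    xorb (xorb (r k i j) (r l i j)) (xorb (r i k l) (r j k l)) =
    xorb (xorb (o k i) (o l i)) (xorb (o k j) (o l j)).
  move=> kl ij u; have [p1 e1] := hq _ _ kl; have [p2 e2] := hq _ _ ij.
  have d := dis _ _ _ _ kl ij u.
  have [k5 l5 i5 j5] : [/\ k < 5, l < 5, i < 5 & j < 5]%N by split; lia.
  have [n1 n2 n3 n4] : [/\ k != i, k != j, l != i & l != j].
    by move: u; rewrite /= !inE; split; lia.
  have := ray_swap p2 p1 d; rewrite e1 e2 -/(le k i) -/(le l i) -/(le k j) -/(le l j).
  by rewrite !leo //; apply; apply: hx'.
have T (k l a b c : nat) : (k < l < 5)%N -> (a < b < 5)%N -> (b < c < 5)%N ->
    uniq [:: k; l; a; b] -> uniq [:: k; l; b; c] -> uniq [:: k; l; a; c] ->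
    xorb (r k a b) (xorb (r k b c) (r k a c)) = xorb (r l a b) (xorb (r l b c) (r l a c)).
  move=> kl ab bc u1 u2 u3; have ac : (a < c < 5)%N by lia.
  have [p1 e1] := hq _ _ kl; have [p2 e2] := hq _ _ ab.
  have [p3 e3] := hq _ _ bc; have [p4 e4] := hq _ _ ac.
  have d1 := dis _ _ _ _ kl ab u1; have d2 := dis _ _ _ _ kl bc u2.
  have d3 := dis _ _ _ _ kl ac u3.
  pose p := q a b ++ q b c ++ rev (belast (P a) (q a c)).
  have E (m : nat) : ray (P m) (P a) p = xorb (r m a b) (xorb (r m b c) (r m a c)).
    rewrite /ray /p !crossings_cat e2 e3; do 2 congr xorb.
    by rewrite -{1}e4; apply: ray_rev.
  rewrite -!E -e1; apply: ray_closed => //.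
  - by rewrite /p !cat_path e2 e3 p2 p3 -[X in path _ X (rev _)]e4 rev_ustep.
  - by rewrite /p !last_cat e2 e3 -[X in last X (rev _)]e4 last_rev_belast.
  - move=> s sk; have := d1 s sk; have := d2 s sk; have := d3 s sk.
    rewrite /p !inE !mem_cat mem_rev !negb_or => /andP[n1 n2] /andP[_ n3] /andP[_ n4].
    rewrite n1 n3 n4 /=; apply/negP => /mem_belast; rewrite inE => /orP[]; exact/negP.
have := xorb_accum (S 0 1 2 3 isT isT isT) (xorb_accum (S 0 2 1 3 isT isT isT)
  (xorb_accum (S 0 3 1 2 isT isT isT) (xorb_accum (S 0 1 2 4 isT isT isT)
  (xorb_accum (S 0 2 1 4 isT isT isT) (xorb_accum (S 0 4 1 2 isT isT isT)
  (xorb_accum (S 0 1 3 4 isT isT isT) (xorb_accum (S 0 3 1 4 isT isT isT)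
  (xorb_accum (S 0 4 1 3 isT isT isT) (xorb_accum (S 0 2 3 4 isT isT isT)
  (xorb_accum (S 0 3 2 4 isT isT isT) (xorb_accum (S 0 4 2 3 isT isT isT)
  (xorb_accum (S 1 2 3 4 isT isT isT) (xorb_accum (S 1 3 2 4 isT isT isT)
  (xorb_accum (S 1 4 2 3 isT isT isT)
  (xorb_accum (T 0 1 2 3 4 isT isT isT isT isT isT)
  (xorb_accum (T 0 2 1 3 4 isT isT isT isT isT isT)
  (xorb_accum (T 0 3 1 2 4 isT isT isT isT isT isT)
  (xorb_accum (T 0 4 1 2 3 isT isT isT isT isT isT)
  (xorb_accum (T 1 2 0 3 4 isT isT isT isT isT isT)
  (xorb_accum (T 1 3 0 2 4 isT isT isT isT isT isT)
  (xorb_accum (T 1 4 0 2 3 isT isT isT isT isT isT)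
  (xorb_accum (T 2 3 0 1 4 isT isT isT isT isT isT)
  (xorb_accum (T 2 4 0 1 3 isT isT isT isT isT isT)
  (xorb_accum (T 3 4 0 1 2 isT isT isT isT isT isT) (erefl false))))))))))))))))))))))))).
(* In the sum every [r] term occurs an even number of times. Each of the five quadruples leaves
   three complementary pairs [o i j], [o j i], so the total is odd. *)
rewrite /o /=; set E := (X in X = false -> _) => h.
suff : E = true by rewrite h.
by rewrite /E; clear; btauto.
Qed.

End Lattice.

From mathcomp Require Import boolp classical_sets.
From mathcomp Require Import topology normedtype.
Import numFieldNormedType.Exports.

(** * Rounding plane curves to lattice walks *)

Section Plane.
Local Open Scope ring_scope.
Local Open Scope classical_set_scope.
Variable R : realType.
Local Notation pt := (int * int)%type.

Lemma within_eps_delta (f : R -> R * R) (x e : R) :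
  {within `[0, 1], continuous f} -> 0 <= x <= 1 -> 0 < e ->
  exists2 d, 0 < d & forall y, 0 <= y <= 1 -> `|y - x| < d ->
    `|(f y).1 - (f x).1| < e /\ `|(f y).2 - (f x).2| < e.
Proof.
move=> /subspace_continuousP fc x01 e0; have /cvg_ballP := fc x x01.
move=> /(_ e e0); rewrite near_withinE => /nbhs_ballP[d /= d0 h].
exists d => // y y01 yx; have : ball (f x) e (f y).
  by apply: h => //; rewrite /ball /= distrC.
by case: (f x) (f y) => x1 x2 [y1 y2] [/= b1 b2]; rewrite !(distrC y1, distrC y2).
Qed.

(** Compactness of the unit interval in a form that serves both to find a common bound
    ([unit_uniform]) and to concatenate lattice walks along an arc ([arc_lattice]). *)
Lemma interval_induction (Q : R -> R -> Prop) :
  (forall a b c, a <= b -> b <= c -> Q a b -> Q b c -> Q a c) ->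
  (forall x, 0 <= x <= 1 -> exists2 d, 0 < d & forall a b, 0 <= a -> a <= x ->
     x <= b -> b <= 1 -> x - a < d -> b - x < d -> Q a b) ->
  Q 0 1.
Proof.
move=> Qtrans Qloc; pose S := [set b : R | 0 <= b <= 1 /\ Q 0 b].
have [d0 d0_gt0 h0] := Qloc 0 (ltac:(by rewrite lexx ler01)).
have S0 : S 0 by split; [rewrite lexx ler01 | apply: h0; rewrite ?lexx ?ler01 // subrr].
have Sub : has_ubound S by exists 1 => b [/andP[]].
have Ssup : has_sup S by split=> //; exists 0.
set c := sup S; have c0 : 0 <= c by apply: ub_le_sup.
have c1 : c <= 1 by apply: ge_sup; [exists 0 | move=> b [/andP[]]].
have [d d_gt0 h] := Qloc c (ltac:(by rewrite c0 c1)).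
have [b [/andP[b0 b1] Qb] bc] := sup_adherent d_gt0 Ssup; rewrite -/c in bc.
have b_le : b <= c by apply: ub_le_sup => //; split=> //; rewrite b0 b1.
have Qc e : c <= e -> e <= 1 -> e - c < d -> Q 0 e.
  move=> ce e1 ec; apply: (Qtrans 0 b e) => //; first exact: le_trans b_le ce.
  by apply: h => //; lra.
have [c_lt|c_ge] := ltP c 1; last first.
  have <- : c = 1 by apply: le_anti; rewrite c1 c_ge.
  by apply: Qc => //; rewrite subrr.
pose e := Num.min 1 (c + d / 2).
have e1 : e <= 1 by rewrite /e ge_min lexx.
have ce : c < e by rewrite /e lt_min c_lt /=; lra.
have ed' : e <= c + d / 2 by rewrite /e ge_min lexx orbT.
have ed : e - c < d by lra.
have : e <= c; last by rewrite leNgt ce.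
by apply: ub_le_sup => //; split; [apply/andP; split=> //; lra | apply: Qc => //; apply: ltW].
Qed.

Definition unit_int (s : R) := 0 <= s <= 1.

Definition pclose (e : R) (x y : R * R) := `|x.1 - y.1| < e /\ `|x.2 - y.2| < e.

Lemma pclose_leq (e e' : R) x y : e <= e' -> pclose e x y -> pclose e' x y.
Proof. by move=> le [h1 h2]; split; apply: lt_le_trans le. Qed.

Lemma pclose_add (e e' : R) x y z : pclose e x y -> pclose e' y z -> pclose (e + e') x z.
Proof.
move=> [h1 h2] [h3 h4]; split.
  by rewrite -(subrKA y.1); apply: le_lt_trans (ler_normD _ _) _; apply: ltrD.
by rewrite -(subrKA y.2); apply: le_lt_trans (ler_normD _ _) _; apply: ltrD.
Qed.

Lemma pclose_sym (e : R) x y : pclose e x y -> pclose e y x.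
Proof. by move=> [h1 h2]; split; rewrite distrC. Qed.

Lemma unit_uniform (P : R -> R -> Prop) :
  (forall d d' s, d <= d' -> P d' s -> P d s) ->
  (forall x, unit_int x -> exists2 d, 0 < d & forall s, unit_int s -> `|s - x| < d -> P d s) ->
  exists2 d, 0 < d & forall s, unit_int s -> P d s.
Proof.
move=> mono loc.
suff [d d0 h] : exists2 d, 0 < d & forall s, 0 <= s -> s <= 1 -> P d s.
  by exists d => // s /andP[]; apply: h.
apply: (@interval_induction (fun a b => exists2 d, 0 < d & forall s, a <= s -> s <= b -> P d s)).
  move=> a b c ab bc [d d0 h] [d' d'0 h']; exists (Num.min d d'); first by rewrite lt_min d0.
  move=> s sa sc; have [sb|sb] := lerP s b.
    by apply: mono (h s sa sb); rewrite ge_min lexx.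
  by apply: mono (h' s (ltW sb) sc); rewrite ge_min lexx orbT.
move=> x x01; have [d d0 h] := loc x x01; exists d => // a b a0 ax xb b1 xa bx.
exists d => // s sa sb; apply: h; first by apply/andP; split; lra.
by rewrite ltr_norml; apply/andP; split; lra.
Qed.

Lemma point_apart (f : R -> R * R) (x : R * R) : {within `[0, 1], continuous f} ->
  (forall s, unit_int s -> f s <> x) ->
  exists2 d, 0 < d & forall s, unit_int s -> ~ pclose d (f s) x.
Proof.
move=> fc fx; apply: unit_uniform => [d d' s le h /(pclose_leq le)//|y y01].
pose m := Num.max `|(f y).1 - x.1| `|(f y).2 - x.2|.
have m0 : 0 < m.
  rewrite /m lt_max !normr_gt0 !subr_eq0 -negb_and; apply/negP => /andP[/eqP e1 /eqP e2].
  by apply: (fx y y01); move: e1 e2; case: (f y) (x) => ? ? [? ?] /= -> ->.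
have m2 : 0 < m / 2 by lra.
have [d d0 h] := within_eps_delta fc y01 m2.
exists (Num.min d (m / 2)); first by rewrite lt_min d0.
move=> s s01; rewrite lt_min => /andP[sd _] cl.
have c1 : pclose (m / 2) (f y) (f s) by apply: pclose_sym; apply: h.
have c2 : pclose (m / 2) (f s) x by apply: pclose_leq cl; rewrite ge_min lexx orbT.
have [h1 h2] := pclose_add c1 c2; have : m < m.
  by rewrite {1}/m gt_max; apply/andP; split; [move: h1 | move: h2]; rewrite -splitr.
by rewrite ltxx.
Qed.

Lemma arcs_apart (f1 f2 : R -> R * R) : {within `[0, 1], continuous f1} ->
  {within `[0, 1], continuous f2} ->
  (forall s s', unit_int s -> unit_int s' -> f1 s <> f2 s') ->
  exists2 d, 0 < d & forall s s', unit_int s -> unit_int s' -> ~ pclose d (f1 s) (f2 s').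
Proof.
move=> c1 c2 ne.
have [d d0 h] : exists2 d, 0 < d & forall s, unit_int s ->
    forall s', unit_int s' -> ~ pclose d (f1 s) (f2 s'); last first.
  by exists d => // s s' h1 h2; apply: h.
apply: unit_uniform => [d d' s le h s' h' /(pclose_leq le)|y y01]; first exact: h.
have [d d0 h] := point_apart c2 (fun s' h' e => ne y s' y01 h' (esym e)).
have d2 : 0 < d / 2 by lra.
have [d' d'0 h'] := within_eps_delta c1 y01 d2.
exists (Num.min d' (d / 2)); first by rewrite lt_min d'0.
move=> s s01; rewrite lt_min => /andP[sd _] s' s'01 cl; apply: (h s' s'01).
have k1 : pclose (d / 2) (f2 s') (f1 s).
  by apply/pclose_sym; apply: pclose_leq cl; rewrite ge_min lexx orbT.
by have := pclose_add k1 (h' s s01 sd); rewrite -splitr.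
Qed.

Definition joined (S : pt -> Prop) (a b : pt) : Prop := exists p,
  [/\ path ustep a p, last a p = b & forall z, z \in a :: p -> S z].

Lemma joined_sub (S S' : pt -> Prop) a b : (forall z, S z -> S' z) ->
  joined S a b -> joined S' a b.
Proof. by move=> sS [p [p1 p2 p3]]; exists p; split=> // z /p3/sS. Qed.

Lemma joined_trans S a b c : joined S a b -> joined S b c -> joined S a c.
Proof.
move=> [p [p1 p2 p3]] [q [q1 q2 q3]].
exists (p ++ q); rewrite cat_path last_cat p2 p1 q1; split=> // z.
rewrite inE mem_cat orbA => /orP[h|h]; first by apply: p3; rewrite inE.
by apply: q3; rewrite inE h orbT.
Qed.

Lemma joined_sym S a b : joined S a b -> joined S b a.
Proof.
move=> [p [p1 <- p3]]; exists (rev (belast a p)).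
rewrite rev_ustep // last_rev_belast; split=> // z.
rewrite inE mem_rev => /orP[/eqP->|/mem_belast]; [exact/p3/mem_last | exact: p3].
Qed.

Section Rounding.
Variables (N t : R).
Hypothesis N_gt0 : 0 < N.

(** [N] refines the grid, and a suitable [t] keeps branch points out of a common column, as
    [lattice_K5] requires. *)
Definition shear (z : R * R) : R := N * (z.1 + t * z.2).

Definition round (z : R * R) : pt := (Num.floor (shear z), Num.floor (N * z.2)).

(** The tolerance 2 adds a displacement below 1 along the curve and the loss of at most 1 in the
    floor. *)
Definition near_pt (A : set (R * R)) (z : pt) : Prop := exists2 w, A w &
  `|z.1%:~R - shear w| <= 2 /\ `|z.2%:~R - N * w.2| <= 2.

(** Two tolerances of 2 give 4 in the sheared coordinates; undoing the shear adds [|t|] times the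
    error of the second coordinate. *)
Lemma near_apart A A' (e : R) z : 4 * (1 + `|t|) < N * e ->
  near_pt A z -> near_pt A' z -> exists w w', [/\ A w, A' w' & pclose e w w'].
Proof.
move=> Ne [w Aw [h1 h2]] [w' Aw' [h3 h4]]; exists w, w'; split=> //.
have t0 := normr_ge0 t.
have k2 : `|N * (w.2 - w'.2)| <= 4.
  have -> : N * (w.2 - w'.2) = (z.2%:~R - N * w'.2) - (z.2%:~R - N * w.2) by lra.
  by apply: le_trans (ler_normB _ _) _; lra.
have k1 : `|N * ((w.1 - w'.1) + t * (w.2 - w'.2))| <= 4.
  have -> : N * ((w.1 - w'.1) + t * (w.2 - w'.2)) =
    (z.1%:~R - shear w') - (z.1%:~R - shear w) by rewrite /shear; lra.
  by apply: le_trans (ler_normB _ _) _; lra.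
have k3 : `|N * (w.1 - w'.1)| <= 4 * (1 + `|t|).
  have -> : N * (w.1 - w'.1) = N * ((w.1 - w'.1) + t * (w.2 - w'.2)) -
     t * (N * (w.2 - w'.2)) by lra.
  apply: le_trans (ler_normB _ _) _; rewrite [X in _ + X]normrM.
  have := ler_wpM2l t0 k2; lra.
have NN : `|N| = N by rewrite gtr0_norm.
rewrite !normrM NN in k2 k3.
split; rewrite -(ltr_pM2l N_gt0); [exact: le_lt_trans k3 Ne | apply: le_lt_trans k2 _].
by apply: le_lt_trans Ne; lra.
Qed.

Lemma floor_close (x y : R) : `|x - y| < 1 -> Num.floor x <= Num.floor y + 1.
Proof.
rewrite ltr_norml => /andP[_ h].
have /andP[h1 _] := floor_itv x; have /andP[_ h2] := floor_itv y.
rewrite intrD in h2; rewrite -ltzD1 -(ltr_int R) !intrD; lra.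
Qed.

Lemma floor_dist (x y : R) : `|x - y| < 1 -> `|(Num.floor y)%:~R - x| <= 2.
Proof.
rewrite ltr_norml => /andP[h3 h4]; have /andP[h1 h2] := floor_itv y.
by rewrite intrD in h2; rewrite ler_norml; apply/andP; split; lra.
Qed.

Lemma round_step (A : set (R * R)) (x y : R * R) : A x ->
  `|shear x - shear y| < 1 -> `|N * x.2 - N * y.2| < 1 ->
  joined (near_pt A) (round x) (round y).
Proof.
move=> Ax d1 d2; set a := round x; set b := round y.
have e1 : a.1 <= b.1 + 1 by apply: floor_close.
have e2 : b.1 <= a.1 + 1 by apply: floor_close; rewrite distrC.
have e3 : a.2 <= b.2 + 1 by apply: floor_close.
have e4 : b.2 <= a.2 + 1 by apply: floor_close; rewrite distrC.
have n0 (u : R) : `|u - u| < 1 by rewrite subrr normr0.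
(* The walk turns at the corner [(b.1, a.2)]. Each coordinate of the three points is the floor of a
   number within 1 of that of [x], so all are near the same point of [A]. *)
have nr z : z \in [:: a; (b.1, a.2); b] -> near_pt A z.
  by rewrite !inE => /or3P[]/eqP->; exists x => //; split; apply: floor_dist.
exists ((if a.1 == b.1 then [::] else [:: (b.1, a.2)]) ++ (if a.2 == b.2 then [::] else [:: b])).
move: nr e1 e2 e3 e4; rewrite /ustep; case: (a) (b) => a1 a2 [b1 b2] /= nr.
have [e|ne] := eqVneq a1 b1; have [e'|ne'] := eqVneq a2 b2; move=> /= ????.
- by rewrite e e'; split=> // z; rewrite inE => /eqP->; apply: nr; rewrite !inE e e' eqxx.
- split=> //; [by rewrite /= e; lia | move=> z].
  by rewrite !inE => /orP[]/eqP->; apply: nr; rewrite !inE eqxx ?orbT.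
- split=> //; [by rewrite /=; lia | by rewrite e' | move=> z].
  by rewrite !inE => /orP[]/eqP->; apply: nr; rewrite !inE eqxx ?orbT.
- by split=> //=; lia.
Qed.

Lemma arc_lattice (f : R -> R * R) : {within `[0, 1], continuous f} ->
  joined (near_pt (f @` `[0, 1])) (round (f 0)) (round (f 1)).
Proof.
move=> fc.
apply: (@interval_induction (fun a b => joined _ (round (f a)) (round (f b))))
  => [a b c _ _|x x01]; first exact: joined_trans.
have t0 := normr_ge0 t; have tp : 0 < 1 + `|t| by lra.
(* With this [e] the scaled and sheared coordinates move by less than [1 / 2] from [x], hence by
   less than 1 between [a] and [b]. *)
pose e := (2 * N * (1 + `|t|))^-1.
have e0 : 0 < e by rewrite invr_gt0 !mulr_gt0.
have Ne : N * (1 + `|t|) * e = 1 / 2.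
  by rewrite /e !invfM mulrA; field; rewrite !gt_eqF.
have [d d0 h] := within_eps_delta fc x01 e0; exists d => // a b a0 ax xb b1 xa bx.
have cl s : 0 <= s -> s <= 1 -> `|s - x| < d ->
    `|shear (f s) - shear (f x)| < 1 / 2 /\ `|N * (f s).2 - N * (f x).2| < 1 / 2.
  move=> s0 s1 sx; have [|k1 k2] := h s _ sx; first by rewrite s0.
  have NN : `|N| = N by rewrite gtr0_norm.
  have j2 : `|N * (f s).2 - N * (f x).2| < N * e.
    by rewrite -mulrBr normrM NN ltr_pM2l.
  have j3 : N * e <= 1 / 2 by rewrite -Ne; have := mulr_ge0 (mulr_ge0 (ltW N_gt0) t0) (ltW e0); lra.
  split; last exact: lt_le_trans j2 j3.
  have -> : shear (f s) - shear (f x) = N * ((f s).1 - (f x).1) + t * (N * (f s).2 - N * (f x).2).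
    by rewrite /shear; lra.
  apply: le_lt_trans (ler_normD _ _) _; rewrite !normrM NN.
  have j1 : N * `|(f s).1 - (f x).1| < N * e by rewrite ltr_pM2l.
  have j4 : `|t| * `|N * (f s).2 - N * (f x).2| <= `|t| * (N * e) by apply: ler_wpM2l => //; apply: ltW.
  by move: Ne; lra.
have [a1 a2] : `|shear (f a) - shear (f x)| < 1 / 2 /\ `|N * (f a).2 - N * (f x).2| < 1 / 2.
  by apply: cl; rewrite ?ltr_norml; lra.
have [c1 c2] : `|shear (f b) - shear (f x)| < 1 / 2 /\ `|N * (f b).2 - N * (f x).2| < 1 / 2.
  by apply: cl; rewrite ?ltr_norml; lra.
apply: round_step; first by exists a => //=; rewrite in_itv /= a0; lra.
  rewrite -(subrKA (shear (f x))); apply: le_lt_trans (ler_normD _ _) _.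
  by rewrite [X in _ + X]distrC; lra.
rewrite -(subrKA (N * (f x).2)); apply: le_lt_trans (ler_normD _ _) _.
by rewrite [X in _ + X]distrC; lra.
Qed.

End Rounding.
End Plane.

(** * A plane drawing has no K_5 minor *)

Section Drawing.
Local Open Scope ring_scope.
Variables (R : realType) (V : finType) (G : plane_graph R V).

Lemma common_scale (I : finType) (P : I -> R -> Prop) :
  (forall i d d', d <= d' -> P i d' -> P i d) ->
  (forall i, exists2 d, 0 < d & P i d) ->
  exists2 d, 0 < d & forall i, P i d.
Proof.
move=> mono h; suff [d d0 hd] : exists2 d, 0 < d & {in enum I, forall i, P i d}.
  by exists d => // i; apply: hd; rewrite mem_enum.
elim: (enum I) => [|i s [d d0 IH]]; first by exists 1.
have [d' d'0 hi] := h i; exists (Num.min d d'); first by rewrite lt_min d0.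
move=> j; rewrite inE => /orP[/eqP->|/IH].
  by apply: mono hi; rewrite ge_min lexx orbT.
by apply: mono; rewrite ge_min lexx.
Qed.

(** A pair with equal first coordinates only forbids [t = 0], any other pair only bounds [t] from
    above; so every small positive [t] works. *)
Lemma generic_shear (I : finType) (x : I -> R * R) : injective x ->
  exists t, injective (fun i => (x i).1 + t * (x i).2).
Proof.
move=> x_inj.
have [d d0 h] : exists2 d, 0 < d & forall ij : I * I, forall t, 0 < t -> t < d ->
    (x ij.1).1 + t * (x ij.1).2 = (x ij.2).1 + t * (x ij.2).2 -> ij.1 = ij.2.
  apply: common_scale => [ij d d' le h t t0 td|[i j] /=].
    by apply: h => //; apply: lt_le_trans le.
  have [e|ne] := eqVneq (x i).1 (x j).1.
    exists 1 => // t t0 _; rewrite e => /addrI/(mulfI (lt0r_neq0 t0)) e2.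
    by apply: x_inj; move: e e2; case: (x i) (x j) => ? ? [? ?] /= -> ->.
  set a := (x i).1 - (x j).1; set b := (x i).2 - (x j).2.
  have a0 : 0 < `|a| by rewrite normr_gt0 subr_eq0.
  have b0 : 0 < 1 + `|b| by have := normr_ge0 b; lra.
  exists (`|a| / (1 + `|b|)); first exact: divr_gt0.
  move=> t t0; rewrite ltr_pdivlMr // => h e.
  have ea : a = - (t * b) by rewrite /a /b; lra.
  by exfalso; move: h; rewrite ea normrN normrM (gtr0_norm t0); lra.
exists (d / 2) => i j e; apply: (h (i, j) (d / 2)) => //; lra.
Qed.

Lemma edges_apart : exists2 d : R, 0 < d & forall e e', e \in edges G -> e' \in edges G ->
  [disjoint e & e'] -> forall w w', curve G e w -> curve G e' w' -> ~ pclose d w w'.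
Proof.
suff [d d0 h] : exists2 d : R, 0 < d & forall ee : {set V} * {set V},
    ee.1 \in edges G -> ee.2 \in edges G -> [disjoint ee.1 & ee.2] ->
    forall w w', curve G ee.1 w -> curve G ee.2 w' -> ~ pclose d w w'.
  by exists d => // e e'; apply: (h (e, e')).
apply: common_scale => [ee d d' le h e1 e2 dis w w' cw cw' /(pclose_leq le)|[e e'] /=].
  exact: h.
have [eG|] := boolP (e \in edges G); last by exists 1.
have [e'G|] := boolP (e' \in edges G); last by exists 1.
have [dis|] := boolP [disjoint e & e']; last by exists 1.
have [u [v [_ eE [f [fc _ _ _ fE]]]]] := edge_arc eG.
have [u' [v' [_ e'E [f' [f'c _ _ _ f'E]]]]] := edge_arc e'G.
have ne : e != e'.
  apply/eqP => ee; move: dis; rewrite -ee -setI_eq0 finset.setIid eE => /eqP/setP/(_ u).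
  by rewrite !inE eqxx.
have [d d0 h] : exists2 d, 0 < d & forall s s', unit_int s -> unit_int s' ->
    ~ pclose d (f s) (f' s').
  apply: arcs_apart => // s s' s01 s'01 ff.
  have c1 : curve G e (f s) by rewrite fE; exists s => //; rewrite /= in_itv.
  have c2 : curve G e' (f s) by rewrite f'E ff; exists s' => //; rewrite /= in_itv.
  have [w _ wE] := edge_edge eG e'G ne (conj c1 c2).
  have we : w \in e by apply: (edge_vertex eG); rewrite wE.
  have we' : w \in e' by apply: (edge_vertex e'G); rewrite wE.
  by have := disjointFr dis we; rewrite we'.
exists d => // _ _ _ w w'; rewrite fE f'E => -[s /= s01 <-] [s' /= s'01 <-].
by apply: h; [move: s01 | move: s'01]; rewrite in_itv.
Qed.

Section Walks.
Variables (N t : R).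
Hypothesis N_gt0 : 0 < N.
Local Notation at_ v := (round N t (pos G v)).

Lemma edge_joined u v : adj G u v ->
  joined (near_pt N t (curve G [set u; v]%SET)) (at_ u) (at_ v).
Proof.
move=> uv; have [u' [v' [_ eE [f [fc _ f0 f1 fE]]]]] := edge_arc uv.
have J := arc_lattice t N_gt0 fc; rewrite f0 f1 -fE in J.
have : u \in [set u'; v']%SET by rewrite -eE !inE eqxx.
have : v \in [set u'; v']%SET by rewrite -eE !inE eqxx orbT.
have nuv : u != v by apply/eqP => uE; move: uv; rewrite uE adj_irrefl.
move: (curve G _) J => A J; rewrite !inE => /orP[]/eqP ve /orP[]/eqP ue.
- by rewrite ve ue eqxx in nuv.
- by rewrite ve ue; apply: joined_sym.
- by rewrite ve ue.
- by rewrite ve ue eqxx in nuv.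
Qed.

Definition near_edge_in (X : {set V}) z :=
  exists e, [/\ e \in edges G, e \subset X & near_pt N t (curve G e) z].

Lemma walk_joined X u v : connect (induced (adj G) X) u v -> u != v ->
  joined (near_edge_in X) (at_ u) (at_ v).
Proof.
have step a b : induced (adj G) X a b -> joined (near_edge_in X) (at_ a) (at_ b).
  move=> /and3P[aX bX ab]; apply: joined_sub (edge_joined ab) => z nz.
  exists [set a; b]%SET; split=> //.
  by apply/fintype.subsetP => w; rewrite !inE => /orP[]/eqP->.
move=> /connectP[p pp ->]; elim: p u pp => [|w p IH] u /=; first by rewrite eqxx.
move=> /andP[uw pw] _; have [<-|ne] := eqVneq w (last w p); first exact: step.
exact: joined_trans (step _ _ uw) (IH _ pw ne).
Qed.

End Walks.

Lemma plane_no_K5 : ~ K5_minor (adj G).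
Proof.
move=> [F [Fconn Fdis Fadj]].
have [c cF] : {c : 'I_5 -> V & forall i, c i \in F i}.
  apply: (boolp.choice (P := fun i x => x \in F i)) => i; have [/finset.set0Pn[x xF] _] := Fconn i; by exists x.
have c_inj : injective (fun i => pos G (c i)).
  move=> i j /pos_inj e; apply/eqP; apply: contraT => /Fdis/disjointFr/(_ (cF i)).
  by rewrite e cF.
have cc i j : i != j -> connect (induced (adj G) (F i :|: F j)) (c i) (c j).
  move=> ij; have [x [y [xF yF xy]]] := Fadj i j ij.
  apply: (connect_trans (y := x)).
    by apply: conn_sub (finset.subsetUl _ _) _; apply: (Fconn i).2.
  apply: (connect_trans (y := y)).
    by apply: conn_edge => //; rewrite inE ?xF ?yF ?orbT.
  by apply: conn_sub (finset.subsetUr _ _) _; apply: (Fconn j).2.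
have [t t_inj] := generic_shear c_inj.
pose X i := (pos G (c i)).1 + t * (pos G (c i)).2.
have [d d0 hd] := edges_apart.
have [d' d'0 hd'] : exists2 d', 0 < d' & forall ij : 'I_5 * 'I_5, ij.1 != ij.2 ->
    d' <= `|X ij.1 - X ij.2|.
  apply: common_scale => [ij d1 d2 le h /h|[i j] /=]; first exact: le_trans.
  have [|ne] := eqVneq i j; first by exists 1.
  exists `|X i - X j| => //; rewrite normr_gt0 subr_eq0.
  by apply: contraNneq ne => /t_inj ->.
have t0 := normr_ge0 t.
(* The first summand gives the branch points distinct columns after rounding; the second makes the
   grid fine compared with the gap [d] between disjoint edges. *)
pose N := d'^-1 + 5 * (1 + `|t|) / d.
have N1 : 0 < d'^-1 by rewrite invr_gt0.
have N2 : 0 < 5 * (1 + `|t|) / d by rewrite divr_gt0 //; lra.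
have N0 : 0 < N by rewrite addr_gt0.
have Nd : 4 * (1 + `|t|) < N * d.
  have -> : N * d = d'^-1 * d + 5 * (1 + `|t|) by rewrite /N; field; rewrite !gt_eqF.
  by have := mulr_gt0 N1 d0; lra.
have Nd' : 1 <= N * d'.
  rewrite /N mulrDl mulVf ?gt_eqF // lerDl; apply: mulr_ge0; exact: ltW.
pose P (i : nat) := round N t (pos G (c (inord i))).
have inne (i j : nat) : (i < j < 5)%N -> (inord i : 'I_5) != inord j.
  by move=> ij; rewrite -val_eqE /= !inordK; lia.
pose S i j := near_edge_in N t (F (inord i) :|: F (inord j)).
have [q hq] : {q : nat * nat -> seq (int * int) & forall ij, (ij.1 < ij.2 < 5)%N ->
    [/\ path ustep (P ij.1) (q ij), last (P ij.1) (q ij) = P ij.2 &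
        forall z, z \in P ij.1 :: q ij -> S ij.1 ij.2 z]}.
  apply: (boolp.choice (P := fun ij p => (ij.1 < ij.2 < 5)%N -> [/\ path ustep (P ij.1) p,
    last (P ij.1) p = P ij.2 & forall z, z \in P ij.1 :: p -> S ij.1 ij.2 z])).
  move=> [i j] /=; have [ij|] := boolP (i < j < 5)%N; last by exists [::].
  have [|p hp] := walk_joined t N0 (cc _ _ (inne _ _ ij)); last by exists p.
  by apply: contraNneq (inne _ _ ij) => e; apply/eqP/c_inj; rewrite e.
apply: (@lattice_K5 P (fun i j => q (i, j))) => [i j ij|i j k l ij kl u s si|i j ij].
- by have [] := hq (i, j) ij.
(* A shared lattice point would be near an edge inside [F i :|: F j] and near one inside
   [F k :|: F l]. These edges have no common end, so they are further apart than that. *)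
- apply/negP => sk.
  have [_ _ /(_ s si) [e [eG eF ne]]] := hq (i, j) ij.
  have [_ _ /(_ s sk) [e' [e'G e'F ne']]] := hq (k, l) kl.
  have [w [w' [cw cw' wd]]] := near_apart N0 Nd ne ne'.
  apply: (hd e e' eG e'G _ w w' cw cw' wd).
  have D (a b : nat) : (a < 5)%N -> (b < 5)%N -> a != b ->
      [disjoint F (inord a) & F (inord b)].
    by move=> a5 b5 ab; apply: Fdis; rewrite -val_eqE /= !inordK.
  apply: disjointWl eF _; apply: disjointWr e'F _.
  move: u; rewrite /= !inE !negb_or !andbT => /and3P[/and3P[_ ik il] /andP[jk jl] _].
  have DU (A B C : {set V}) : [disjoint A & C] -> [disjoint B & C] -> [disjoint A :|: B & C].
    by move=> h1 h2; rewrite finset.disjoints_subset finset.subUset -!finset.disjoints_subset h1.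
  by apply: (DU); rewrite disjoint_sym; apply: (DU); apply: (D); move: ij kl ik il jk jl; clear; lia.
- have ne := hd' (inord i, inord j) (inne _ _ ij).
  apply/eqP => /= e; have /andP[h1 h2] := floor_itv (shear N t (pos G (c (inord i)))).
  have /andP[h3 h4] := floor_itv (shear N t (pos G (c (inord j)))).
  rewrite e in h1 h2; rewrite intrD in h2 h4.
  have : `|N * (X (inord i) - X (inord j))| < 1.
    rewrite ltr_norml /X; rewrite /shear in h1 h2 h3 h4.
    by apply/andP; split; lra.
  rewrite normrM (gtr0_norm N0) ltNge; have := ler_wpM2l (ltW N0) ne => /=; lra.
Qed.

End Drawing.

Theorem theorem5p2 (R : realType) (V : finType) (G : plane_graph R V)
    (H : {set {set V}})
    (H_connected : forall A : {set V}, A \in H -> connected_set (adj G) A)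
    (H_spans : spans (adj G) H) :
  exists (G' : plane_graph R V) (M : {set {set V}}),
    [/\ fortification G G',
        zspans (adj G') H 8 &
        impression (adj G') H M 73936 80].
Proof.
have [M hM] := K5_free_impression (@adj_sym _ _ G) H_spans H_connected (@plane_no_K5 _ _ G).
exists G, M; split=> //.
  split=> //; exists (fun=> classical_sets.set0).
  by split=> [e|e e'|e]; rewrite finset.setDv inE.
move=> u v /H_spans[A AH /andP[uA vA]]; exists A, A; split=> //.
by exists [::].
Qed.
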